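(* Let $(\mathcal{A},\varphi)$ be a $C^*$-probability space and let $\mathbb{X}\in\mathcal{A}$ be an invertible self-adjoint element such that for every $n\ge 1$ $$\mathcal{R}_{n+1}\bigl(\mathbb{X},\underbrace{\mathbb{X}^{-1},\mathbb{X}^{-1},\ldots,\mathbb{X}^{-1}}_{n}\bigr)=-\mathcal{R}_n(\mathbb{X}^{-1}).$$ Then for every $n\ge 1$ $$\mathcal{R}_n(\mathbb{X}^{-1})=\frac{1}{(\mathcal{R}_1(\mathbb{X})-1)^{2n-1}}\,C_{n-1}.$$ In particular, $\mathbb{X}^{-1}$ has a free Gamma distribution and $\mathbb{X}$ has a free Poisson distribution.
   Context: A $C^*$-probability space is a pair $(\mathcal{A},\varphi)$ with $\mathcal{A}$ a unital $C^*$-algebra with unit $\mathbb{I}$ and $\varphi:\mathcal{A}\to\mathbb{C}$ linear with $\varphi(\mathbb{I})=1$ and $\varphi(\mathbb{X}^*\mathbb{X})\ge 0$ for all $\mathbb{X}$. The distribution of a self-adjoint $\mathbb{X}\in\mathcal{A}$ is the probability measure $\mu$ on $\mathbb{R}$ with $\varphi(\mathbb{X}^r)=\int t^r\,\mu(dt)$ for all $r\ge 1$. Free cumulants: $NC(m)$ is the set of non-crossing partitions of $\{1,\dots,m\}$. The (joint) free cumulants are the $k$-linear maps $\mathcal{R}_k:\mathcal{A}^k\to\mathbb{C}$, $k\ge1$, defined recursively by $$\varphi(\mathbb{X}_1\cdots\mathbb{X}_m)=\sum_{\chi\in NC(m)}\prod_{B\in\chi}\mathcal{R}_{|B|}(\mathbb{X}_i,\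 i\in B),\qquad m\ge 1,$$ where within each block the arguments are taken in increasing order of index. One writes $\mathcal{R}_n(\mathbb{Z})=\mathcal{R}_n(\mathbb{Z},\dots,\mathbb{Z})$ ($n$ copies). $C_k=\frac{1}{k+1}\binom{2k}{k}$, $k\ge 0$, are the Catalan numbers. Free Poisson distribution: for $\lambda\ge 0$, $\alpha>0$, the free Poisson law with parameters $(\lambda,\alpha)$ is $\nu(\lambda,\alpha)=\max\{0,1-\lambda\}\,\delta_0+\tilde\nu$, where $\tilde\nu$ is supported on $(\alpha(1-\sqrt\lambda)^2,\alpha(1+\sqrt\lambda)^2)$ with density $\frac{1}{2\pi\alpha x}\sqrt{4\lambda\alpha^2-(x-\alpha(1+\lambda))^2}$. Free Gamma distribution: the law, for some $\lambda>1$ and $\alpha>0$, with density $$\frac{(\lambda-1)\sqrt{\frac{4\lambda}{\alpha^2(\lambda-1)^4}-\left(x-\frac{\lambda+1}{\alpha(\lambda-1)^2}\right)^2}}{2\pi x^2}$$ on the interval $\left(\frac{1}{\alpha(1+\sqrt\lambda)^2},\frac{1}{\alpha(1-\sqrt\lambda)^2}\right)$; this is the law of the inverse of a free Poisson variable with parameters $(\lambda,\alpha)$. *)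

(* Defs.v *)
From HB Require Import structures.
From mathcomp Require Import all_boot all_order all_algebra.
From mathcomp Require Import all_classical all_reals all_analysis.
From mathcomp.real_closed Require Import complex.

Set Implicit Arguments.
Unset Strict Implicit.
Unset Printing Implicit Defensive.

Import Order.TTheory GRing.Theory Num.Theory.

Local Open Scope ring_scope.
Local Open Scope complex_scope.

(* Unital C*-algebras. The unitRingType structure only names the (unique)
   inverses of the invertible elements. The norm is a separate operation
   because HB rejects a structure that is both a ring and a normed module,
   for lack of a join below numDomainType. *)
HB.mixin Record isCStarAlgebra (R : realType) A
    of GRing.UnitAlgebra R[i] A := {
  star : A -> A;
  starK : forall x : A, star (star x) = x;
  starD : forall x y : A, star (x + y) = star x + star y;
  starZ : forall (a : R[i]) (x : A), star (a *: x) = a^* *: star x;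
  starM : forall x y : A, star (x * y) = star y * star x;
  cnorm : A -> R;
  cnorm_eq0 : forall x : A, cnorm x = 0 -> x = 0;
  cnormD_le : forall x y : A, cnorm (x + y) <= cnorm x + cnorm y;
  cnormZ : forall (a : R[i]) (x : A),
    (cnorm (a *: x))%:C = `|a| * (cnorm x)%:C;
  cnormM_le : forall x y : A, cnorm (x * y) <= cnorm x * cnorm y;
  cnorm_starM : forall x : A, cnorm (star x * x) = cnorm x ^+ 2;
  cnorm_complete : forall u : nat -> A,
    (forall e : R, 0 < e -> exists N : nat, forall m n : nat,
      (N <= m)%N -> (N <= n)%N -> cnorm (u m - u n) < e) ->
    exists l : A, forall e : R, 0 < e -> exists N : nat, forall n : nat,
      (N <= n)%N -> cnorm (u n - l) < e
}.

#[short(type="cStarAlgType")]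
HB.structure Definition CStarAlgebra (R : realType) :=
  {A of GRing.UnitAlgebra R[i] A & isCStarAlgebra R A}.

(* On R[i], [0 <= z] means that z is real and nonnegative. *)
Definition is_state (R : realType) (A : cStarAlgType R) (phi : {scalar A}) :=
  phi 1 = 1 /\ forall x : A, 0 <= phi (star x * x).

Definition selfadjoint (R : realType) (A : cStarAlgType R) (x : A) :=
  star x = x.

Definition noncrossing (m : nat) (P : {set {set 'I_m}}) : bool :=
  [forall B1 in P, forall B2 in P, (B1 != B2) ==>
    [forall a in B1, forall b in B2, forall c in B1, forall d in B2,
      ~~ [&& (a < b)%N, (b < c)%N & (c < d)%N]]].

Definition NC (m : nat) : {set {set {set 'I_m}}} :=
  [set P | finset.partition P [set: 'I_m] && noncrossing P]%SET.

Section FreeCumulants.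
Variables (C : comNzRingType) (A : nzRingType) (phi : A -> C).

(* [enum B] lists the elements of B in increasing order. *)
Definition block_args (s : seq A) (B : {set 'I_(size s)}) : seq A :=
  [seq s`_i | i : 'I_(size s) <- enum B].

(* The moment-cumulant formula solved for the term of the one-block partition;
   n bounds the depth of the recursion. *)
Fixpoint free_cumulant_rec (n : nat) (s : seq A) : C :=
  if n is n'.+1 then
    phi (\prod_(x <- s) x)
    - \sum_(P in NC (size s) | P != [set [set: 'I_(size s)]]%SET)
        \prod_(B in P) free_cumulant_rec n' (block_args B)
  else 0.

(* R_k(x_1, ..., x_k) for s = [:: x_1; ...; x_k] and k >= 1; it is determined
   by [free_cumulantP] below. *)
Definition free_cumulant (s : seq A) : C := free_cumulant_rec (size s) s.

Lemma size_block_args (s : seq A) (B : {set 'I_(size s)}) :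
  size (block_args B) = #|B|.
Proof. by rewrite size_map -cardE. Qed.

Lemma block_gt0 (m : nat) (P : {set {set 'I_m}}) (B : {set 'I_m}) :
  P \in NC m -> B \in P -> (0 < #|B|)%N.
Proof.
rewrite inE => /andP[/and3P[_ _ nP0] _] BP.
by rewrite card_gt0; apply: contra nP0 => /eqP <-.
Qed.

Lemma block_lt (m : nat) (P : {set {set 'I_m}}) (B : {set 'I_m}) :
  P \in NC m -> P != [set [set: 'I_m]]%SET -> B \in P -> (#|B| < m)%N.
Proof.
rewrite inE => /andP[/and3P[/eqP covP trivP nP0] _] PT BP.
rewrite ltnNge; apply/negP => leB; have BT : B = [set: 'I_m]%SET.
  by apply/eqP; rewrite eqEcard finset.subsetT cardsT card_ord.
case/negP: PT; rewrite finset.eqEsubset finset.sub1set -BT BP andbT.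
apply/fintype.subsetP => D DP; rewrite inE; apply/eqP; apply: contraTeq isT => DB.
have := finset.disjoint_setI0 (finset.trivIsetP trivP _ _ DP BP DB).
by rewrite BT finset.setIT => D0; rewrite -D0 DP in nP0.
Qed.

Lemma one_block_NC (m : nat) : (0 < m)%N -> [set [set: 'I_m]]%SET \in NC m.
Proof.
move=> m0; rewrite inE; apply/andP; split.
  apply/and3P; split; first by rewrite /finset.cover finset.big_set1.
    by apply/finset.trivIsetP => X Y /finset.set1P-> /finset.set1P->; rewrite eqxx.
  by rewrite inE eq_sym -card_gt0 cardsT card_ord.
apply/forall_inP => X /finset.set1P->; apply/forall_inP => Y /finset.set1P->.
by rewrite eqxx.
Qed.

Lemma free_cumulant_recE (n : nat) (s : seq A) :
  (0 < size s <= n)%N -> free_cumulant_rec n s = free_cumulant s.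
Proof.
suff H k : forall n s, (0 < size s <= n)%N -> (size s <= k)%N ->
    free_cumulant_rec n s = free_cumulant_rec k s by move=> /H; exact.
elim: k {n s} => [|k IH] [|n] s /andP[s0 sn] sk //=.
- by rewrite leqNgt s0 in sk.
- by rewrite leqNgt s0 in sn.
congr (_ - _); apply: eq_bigr => P /andP[PNC PT]; apply: eq_bigr => B BP.
have Bs := block_lt PNC PT BP.
apply: IH; rewrite size_block_args ?(block_gt0 PNC BP) /= -ltnS.
  exact: leq_trans Bs sn.
exact: leq_trans Bs sk.
Qed.

Lemma free_cumulantP (s : seq A) : (0 < size s)%N ->
  phi (\prod_(x <- s) x) =
  \sum_(P in NC (size s)) \prod_(B in P) free_cumulant (block_args B).
Proof.
move=> s0; rewrite (bigD1 _ (one_block_NC s0)) /= finset.big_set1.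
have -> : block_args [set: 'I_(size s)]%SET = s.
  rewrite /block_args enum_setT -enumT.
  rewrite (map_comp (nth 0 s) (@nat_of_ord _)) val_enum_ord.
  by rewrite -/(mkseq _ _) mkseq_nth.
rewrite -(@free_cumulant_recE (size s).+1) ?s0 ?leqnSn //=.
set S := (X in _ - X + _); rewrite [X in _ + X](_ : _ = S) ?subrK //.
apply: eq_bigr => P /andP[PNC PT]; apply: eq_bigr => B BP.
rewrite free_cumulant_recE // size_block_args (block_gt0 PNC BP) /=.
exact: ltnW (block_lt PNC PT BP).
Qed.

End FreeCumulants.

Definition catalan (F : fieldType) (k : nat) : F :=
  1 / k.+1%:R * 'C(k.*2, k)%:R.

Section Laws.
Local Open Scope classical_set_scope.
Variable R : realType.
Implicit Types (lambda alpha x : R).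

Definition free_poisson_density lambda alpha x : R :=
  1 / (2 * pi * alpha * x) *
  Num.sqrt (4 * lambda * alpha ^+ 2 - (x - alpha * (1 + lambda)) ^+ 2).

Definition free_poisson_support lambda alpha : set R :=
  `]alpha * (1 - Num.sqrt lambda) ^+ 2, alpha * (1 + Num.sqrt lambda) ^+ 2[.

Definition free_poisson lambda alpha : set (measurableTypeR R) -> \bar R :=
  fun B => ((Num.max 0 (1 - lambda))%:E * \d_(0%R : R) B
    + \int[lebesgue_measure]_(x in B `&` free_poisson_support lambda alpha)
        (free_poisson_density lambda alpha x)%:E)%E.

Definition free_gamma_density lambda alpha x : R :=
  (lambda - 1) *
  Num.sqrt (4 * lambda / (alpha ^+ 2 * (lambda - 1) ^+ 4)
            - (x - (lambda + 1) / (alpha * (lambda - 1) ^+ 2)) ^+ 2)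
  / (2 * pi * x ^+ 2).

Definition free_gamma_support lambda alpha : set R :=
  `]1 / (alpha * (1 + Num.sqrt lambda) ^+ 2),
    1 / (alpha * (1 - Num.sqrt lambda) ^+ 2)[.

Definition free_gamma lambda alpha : set (measurableTypeR R) -> \bar R :=
  fun B => (\int[lebesgue_measure]_(x in B `&` free_gamma_support lambda alpha)
              (free_gamma_density lambda alpha x)%:E)%E.

Variables (A : cStarAlgType R) (phi : A -> R[i]).

(* Integrability is required because the integral of a non-integrable function
   is a default value. *)
Definition is_distribution (x : A) (mu : probability (measurableTypeR R) R) :=
  forall r : nat, (1 <= r)%N ->
    mu.-integrable [set: measurableTypeR R] (fun t => (t ^+ r)%:E) /\
    phi (x ^+ r) = (\int[mu]_t (t ^+ r))%R%:C.

Definition has_law (x : A) (nu : set (measurableTypeR R) -> \bar R) :=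
  exists mu : probability (measurableTypeR R) R,
    is_distribution x mu /\ forall B, measurable B -> mu B = nu B.

Definition has_free_poisson_distribution (x : A) :=
  exists lambda alpha : R,
    [/\ 0 <= lambda, 0 < alpha & has_law x (free_poisson lambda alpha)].

Definition has_free_gamma_distribution (x : A) :=
  exists lambda alpha : R,
    [/\ 1 < lambda, 0 < alpha & has_law x (free_gamma lambda alpha)].

End Laws.

(* Main.v *)
(* Let Y = X^-1 and c = R_1(X) - 1, and let M(z), R(w) be the moment and the
   cumulant series of Y. Sorting the noncrossing partitions by the block of the
   first element gives M = 1 + R(zM) and, with the hypothesis on the mixed
   cumulants, R_1(X) + zM = R_1(X) M - M R(zM). Hence R^2 - c R + w = 0, whose
   solution is the Catalan series, and M^2 - (c + 2 - z) M + c + 1 = 0; the second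
   equation is turned into a three-term linear recursion for the moments of Y by
   differentiating the square root of its discriminant. The variance of Y is
   c^-3, so c > 0.

   Integrating the derivative of x^k w^3, where w is the square root of
   (x - a)(b - x), shows that the moments of the free gamma law and the negative
   moments of the free Poisson law with parameters (c + 1, 1) satisfy the same
   recursion. The positive moments of X need no functional calculus: put
   U = 1 - a Y with a the left end of the support of the free Poisson law. Once
   the moments of order < n agree, the difference between phi(X^n U^K) and the
   corresponding integral is the same for all K, and it tends to 0 as K grows
   because |phi(X^n U^K)| is controlled by phi(U^2K), an integral which is already
   known. *)

From HB Require Import structures.
Require Import Defs.
From mathcomp Require Import all_boot all_order all_algebra.
From mathcomp Require Import zify ring lra.

Set Implicit Arguments.
Unset Strict Implicit.
Unset Printing Implicit Defensive.

Import Order.TTheory GRing.Theory Num.Theory.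
Local Open Scope ring_scope.

(** * Sums over noncrossing partitions *)

Lemma noncrossingP (N : nat) (P : {set {set 'I_N}}) :
  reflect (forall B1 B2, B1 \in P -> B2 \in P -> B1 != B2 ->
             forall a b c d : 'I_N, a \in B1 -> b \in B2 -> c \in B1 ->
               d \in B2 -> (a < b)%N -> (b < c)%N -> (c < d)%N -> False)
          (noncrossing P).
Proof.
apply: (iffP idP) => [nc B1 B2 B1P B2P B12 a b c d aB bB cB dB ab bc cd|H].
  move/forall_inP: nc => /(_ _ B1P) /forall_inP /(_ _ B2P) /implyP /(_ B12).
  move=> /forall_inP /(_ _ aB) /forall_inP /(_ _ bB) /forall_inP /(_ _ cB).
  by move=> /forall_inP /(_ _ dB); rewrite ab bc cd.
apply/forall_inP => B1 B1P; apply/forall_inP => B2 B2P; apply/implyP => B12.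
apply/forall_inP => a aB; apply/forall_inP => b bB; apply/forall_inP => c cB.
by apply/forall_inP => d dB; apply/negP => /and3P[]; exact: (H B1 B2).
Qed.

Lemma noncrossingS (N : nat) (P Q : {set {set 'I_N}}) :
  P \subset Q -> noncrossing Q -> noncrossing P.
Proof.
move=> /subsetP PQ /noncrossingP nc; apply/noncrossingP => B1 B2 B1P B2P.
exact: nc (PQ _ B1P) (PQ _ B2P).
Qed.

(** The ground set is an arbitrary subset of ['I_N] because the recursion below cuts it into pieces
    that need not be initial segments. *)
Definition NCon (N : nat) (D : {set 'I_N}) : {set {set {set 'I_N}}} :=
  [set P | partition P D && noncrossing P].

Section NoncrossingSums.
Variable K : comNzRingType.
Implicit Types (N : nat) (f g : nat -> K).

Lemma partition_sub (T : finType) (P : {set {set T}}) (D B : {set T}) :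
  partition P D -> B \in P -> B \subset D.
Proof. by move=> /cover_partition <- /bigcup_sup; exact. Qed.

Lemma partition_eq_block (T : finType) (P : {set {set T}}) (D B1 B2 : {set T})
    (z : T) : partition P D -> B1 \in P -> B2 \in P -> z \in B1 -> z \in B2 ->
  B1 = B2.
Proof.
move=> /partition_trivIset tP B1P B2P z1 z2.
by rewrite -(def_pblock tP B1P z1) (def_pblock tP B2P z2).
Qed.

Lemma partition_saturated (T : finType) (P : {set {set T}}) (D E : {set T}) :
  partition P (D :|: E) -> [disjoint D & E] ->
  [forall B in P, (B \subset D) || (B \subset E)] -> partition (P ::&: D) D.
Proof.
move=> pP dDE /forall_inP sP; apply/and3P; split.
- apply/eqP/setP => z; apply/bigcupP/idP => [[B]|zD].
    by rewrite inE => /andP[_ /subsetP BD] /BD.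
  have zP : z \in cover P by rewrite (cover_partition pP) inE zD.
  exists (pblock P z); last by rewrite mem_pblock.
  rewrite inE pblock_mem //=; case/orP: (sP _ (pblock_mem zP)) => // /subsetP.
  move=> /(_ z); rewrite mem_pblock zP => /(_ isT) zE.
  by move: dDE => /disjointFr /(_ zD); rewrite zE.
- apply: trivIsetS (partition_trivIset pP).
  by apply/subsetP => B; rewrite inE => /andP[].
- by rewrite inE (partition0 pP).
Qed.

Lemma partitionU_saturated (T : finType) (P : {set {set T}}) (D E : {set T}) :
  partition P (D :|: E) -> [disjoint D & E] ->
  [forall B in P, (B \subset D) || (B \subset E)] ->
  [/\ partition (P ::&: D) D, partition (P ::&: E) E
    & P = (P ::&: D) :|: (P ::&: E)].
Proof.
move=> pP dDE sP; split; first exact: partition_saturated sP.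
- apply: (@partition_saturated _ _ _ D); rewrite 1?setUC 1?disjoint_sym //.
  by apply/forall_inP => B /(forall_inP sP); rewrite orbC.
- apply/setP => B; rewrite !inE; case BP : (B \in P) => //=.
  by rewrite (forall_inP sP _ BP).
Qed.

(** A partition whose blocks all lie in [D] or in [E] is a pair of partitions. Four alternating
    points of [D] and [E] always contain two points of [D] around one of [E], which the second
    hypothesis excludes, so no crossing appears when the pair is put together. The predicate [Q]
    restricts the part on [E]. *)
Lemma sum_NConU (N : nat) (D E : {set 'I_N}) (Q : pred {set {set 'I_N}})
    (w : {set 'I_N} -> K) :
  [disjoint D & E] ->
  (forall a b c : 'I_N, a \in D -> c \in D -> b \in E ->
     (a < b)%N -> (b < c)%N -> False) ->
  \sum_(P in NCon (D :|: E) |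
        [forall B in P, (B \subset D) || (B \subset E)] && Q (P ::&: E))
     \prod_(B in P) w B =
  (\sum_(P in NCon D) \prod_(B in P) w B) *
  (\sum_(P in NCon E | Q P) \prod_(B in P) w B).
Proof.
move=> dDE cvx; rewrite big_distrlr /= pair_big /=.
(* A nonempty block cannot lie in both [D] and [E], so restriction recovers the two partitions from
   their union. *)
have dP (P1 P2 : {set {set 'I_N}}) : partition P1 D -> partition P2 E ->
    [/\ (P1 :|: P2) ::&: D = P1, (P1 :|: P2) ::&: E = P2 & [disjoint P1 & P2]].
  move=> pP1 pP2.
  have nsub (F G : {set 'I_N}) P (B : {set 'I_N}) : [disjoint F & G] ->
      partition P F -> B \in P -> ~~ (B \subset G).
    move=> dFG pP BP; apply/negP => BG.
    have := partition_neq0 pP BP; rewrite -subset0.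
    rewrite -(disjoint_setI0 dFG) subsetI BG andbT.
    by rewrite (partition_sub pP BP).
  have dED : [disjoint E & D] by rewrite disjoint_sym.
  split.
  - apply/setP => B; rewrite !inE; apply/idP/idP => [/andP[/orP[//|BP2]]|BP1].
      by rewrite (negbTE (nsub _ _ _ _ dED pP2 BP2)).
    by rewrite BP1 (partition_sub pP1 BP1).
  - apply/setP => B; rewrite !inE; apply/idP/idP => [/andP[/orP[BP1|//]]|BP2].
      by rewrite (negbTE (nsub _ _ _ _ dDE pP1 BP1)).
    by rewrite BP2 orbT (partition_sub pP2 BP2).
  - rewrite disjoint_subset; apply/subsetP => B BP1; rewrite inE.
    apply/negP => BP2; move: (nsub _ _ _ _ dDE pP1 BP1).
    by rewrite (partition_sub pP2 BP2).
rewrite (reindex_onto (fun p : {set {set 'I_N}} * {set {set 'I_N}} => p.1 :|: p.2)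
   (fun P => (P ::&: D, P ::&: E))) /=; last first.
  move=> P /andP[]; rewrite inE => /andP[pP _] /andP[sP _].
  by have [_ _ eP] := partitionU_saturated pP dDE sP; rewrite -eP.
apply: eq_big => [[P1 P2]|[P1 P2] /=]; rewrite ?inE /=; last first.
  move=> /andP[/andP[/andP[pP nc] /andP[sP _]] /eqP[e1 e2]].
  have [pD pE _] := partitionU_saturated pP dDE sP; rewrite e1 e2 in pD pE.
  have [_ _ dPP] := dP _ _ pD pE; rewrite -bigU //=.
  by apply: eq_bigl => B; rewrite !inE.
apply/idP/idP.
  move=> /andP[/andP[/andP[pP nc] /andP[sP QP]] /eqP[e1 e2]].
  have [pD pE _] := partitionU_saturated pP dDE sP; rewrite e1 e2 in pD pE.
  rewrite pD pE /=.
  rewrite (noncrossingS (subsetUl _ _) nc) (noncrossingS (subsetUr _ _) nc) /=.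
  by move: QP; rewrite e2.
move=> /andP[/andP[pD nc1] /andP[/andP[pE nc2] QP]].
have [-> -> dPP] := dP _ _ pD pE; rewrite eqxx QP !andbT.
apply/andP; split; first apply/andP; first split.
- apply/and3P; split.
  + by rewrite /cover bigcup_setU /= -!/(cover _) (cover_partition pD)
    (cover_partition pE).
  + apply: trivIsetU; rewrite ?(partition_trivIset pD) ?(partition_trivIset pE) //.
    by rewrite (cover_partition pD) (cover_partition pE).
  + by rewrite inE negb_or (partition0 pD) (partition0 pE).
- have xDE z : z \in D -> z \in E -> False by move=> zD zE;
  move: dDE => /disjointFr /(_ zD); rewrite zE.
  apply/noncrossingP => B1 B2; rewrite !inE => /orP[B1P|B1P] /orP[B2P|B2P].
  + by move/noncrossingP: nc1; apply.
  + have /subsetP s1 := partition_sub pD B1P.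
    have /subsetP s2 := partition_sub pE B2P.
    by move=> _ a b c d /s1 aD /s2 bE /s1 cD _ ab bc _; exact: (cvx a b c).
  + have /subsetP s1 := partition_sub pE B1P.
    have /subsetP s2 := partition_sub pD B2P.
    by move=> _ a b c d _ /s2 bD /s1 cE /s2 dD _ bc cd; exact: (cvx b c d).
  + by move/noncrossingP: nc2; apply.
- apply/forall_inP => B; rewrite !inE => /orP[BP|BP].
    by rewrite (partition_sub pD BP).
  by rewrite (partition_sub pE BP) orbT.
Qed.


Lemma partition_pointwise (T : finType) (P : {set {set T}}) (D : {set T}) :
  (forall B, B \in P -> B != set0) ->
  (forall z, reflect (exists2 B, B \in P & z \in B) (z \in D)) ->
  (forall B1 B2 z, B1 \in P -> B2 \in P -> z \in B1 -> z \in B2 -> B1 = B2) ->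
  partition P D.
Proof.
move=> nz cov tr; apply/and3P; split.
- by apply/eqP/setP => z; apply/bigcupP/cov.
- apply/trivIsetP => B1 B2 B1P B2P; apply: contraR => /pred0Pn [z /andP[/= z1 z2]].
  by rewrite (tr _ _ z B1P B2P).
- by apply/negP => /nz; rewrite eqxx.
Qed.

Lemma partition_coverP (T : finType) (P : {set {set T}}) (D : {set T}) (z : T) :
  partition P D -> reflect (exists2 B, B \in P & z \in B) (z \in D).
Proof. by move=> /cover_partition <-; exact: bigcupP. Qed.

(** * Merging the two least elements of a set when they share a block *)

Section Collapse.
Variables (N : nat) (D : {set 'I_N}) (x y : 'I_N).
Hypotheses (xD : forall z, z \in D -> (x < z)%N).
Hypotheses (yD : y \in D) (ymin : forall z, z \in D -> (y <= z)%N).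

Let insx (B : {set 'I_N}) := if y \in B then x |: B else B.

Let xND : x \notin D.
Proof. by apply/negP => /xD; rewrite ltnn. Qed.

Let xNB P B : partition P D -> B \in P -> x \notin B.
Proof. by move=> pP BP; apply: contra xND; apply/subsetP/(partition_sub pP BP). Qed.

Let mem_insx B z : (z \in insx B) = (z \in B) || (z == x) && (y \in B).
Proof. by rewrite /insx; case: ifP => yB; rewrite ?inE 1?orbC ?andbT ?andbF ?orbF. Qed.

Let joined (P : {set {set 'I_N}}) := [exists B in P, (x \in B) && (y \in B)].

Let same_block P B : partition P (x |: D) -> joined P -> B \in P ->
  (x \in B) = (y \in B).
Proof.
move=> pP /exists_inP [B0 B0P /andP[xB yB]] BP; apply/idP/idP => [x1|y1].
  by rewrite (partition_eq_block pP BP B0P x1 xB).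
by rewrite (partition_eq_block pP BP B0P y1 yB).
Qed.

Let y_neq_x : y != x.
Proof. by apply: contraNneq xND => <-. Qed.

Let insxK P B : partition P D -> B \in P -> insx B :\ x = B.
Proof.
move=> pP BP; apply/setP => z; rewrite !inE mem_insx.
have := xNB pP BP; case: (eqVneq z x) => [->|_] //= /negbTE; last by rewrite orbF.
by move->.
Qed.

Let delxK P B : partition P (x |: D) -> joined P -> B \in P -> insx (B :\ x) = B.
Proof.
move=> pP jP BP; apply/setP => z; rewrite mem_insx !inE y_neq_x /=.
case: (eqVneq z x) => [->|_] /=; last by rewrite orbF.
by rewrite (same_block pP jP BP).
Qed.

Let NCon_insx P : P \in NCon D -> (insx @: P \in NCon (x |: D)) && joined (insx @: P).
Proof.
rewrite !inE => /andP[pP nc].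
have inj B1 B2 z : B1 \in P -> B2 \in P -> z \in insx B1 -> z \in insx B2 -> B1 = B2.
  move=> B1P B2P; rewrite !mem_insx; case: (eqVneq z x) => [->|_] /=.
    rewrite (negbTE (xNB pP B1P)) (negbTE (xNB pP B2P)) /=.
    exact: partition_eq_block pP B1P B2P.
  rewrite !orbF; exact: partition_eq_block pP B1P B2P.
apply/andP; split; last first.
  have [B BP yB] := elimT (partition_coverP y pP) yD.
  apply/exists_inP; exists (insx B); first exact: imset_f.
  by rewrite !mem_insx eqxx yB orbT.
apply/andP; split.
  apply: partition_pointwise.
  - move=> _ /imsetP[B BP ->]; apply: contraTneq (partition_neq0 pP BP) => e.
    by rewrite -(insxK pP BP) e set0D eqxx.
  - move=> z; apply: (iffP idP) => [|[_ /imsetP[B BP ->]]]; last first.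
      rewrite mem_insx !inE => /orP[zB|/andP[-> //]].
      by rewrite (subsetP (partition_sub pP BP)) ?orbT.
    rewrite !inE => zxD.
    have [u uD hu] : exists2 u, u \in D & (z == u) || (z == x) && (u == y).
      by case/orP: zxD => [->|zD]; [exists y; rewrite // eqxx orbT|exists z;
        rewrite ?eqxx].
    have [B BP uB] := elimT (partition_coverP u pP) uD.
    exists (insx B); first exact: imset_f.
    rewrite mem_insx; case/orP: hu => [/eqP ->|/andP[-> /eqP <-]].
      by rewrite uB.
    by rewrite uB orbT.
  - move=> _ _ z /imsetP[B1 B1P ->] /imsetP[B2 B2P ->] z1 z2.
    by rewrite (inj _ _ _ B1P B2P z1 z2).
apply/noncrossingP => _ _ /imsetP[B1 B1P ->] /imsetP[B2 B2P ->] B12 a b c d.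
have {}B12 : B1 != B2 by apply: contraNneq B12 => ->.
(* As the least element, [x] can only be the first point [a] of a crossing. It is then replaced with
   [y], which lies in the same block of [P] and, being the least element of [D], still precedes
   [b]. *)
have gex B z : B \in P -> z \in insx B -> (x <= z)%N.
  move=> BP; rewrite mem_insx => /orP[zB|/andP[/eqP -> //]].
  exact: ltnW (xD (subsetP (partition_sub pP BP) _ zB)).
have inB B z w : B \in P -> z \in insx B -> (x <= w)%N -> (w < z)%N -> z \in B.
  move=> BP; rewrite mem_insx => /orP[//|/andP[/eqP -> _]] xw.
  by rewrite ltnNge xw.
move=> a1 b2 c1 d2 ab bc cd; have xa := gex _ _ B1P a1.
have xb := leq_trans xa (ltnW ab); have xc := leq_trans xb (ltnW bc).
have {}b2 := inB _ _ _ B2P b2 xa ab.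
have {}c1 := inB _ _ _ B1P c1 xb bc.
have {}d2 := inB _ _ _ B2P d2 xc cd.
move: a1; rewrite mem_insx => /orP[a1|/andP[_ y1]].
  exact: (noncrossingP _ nc B1 B2 B1P B2P B12 a b c d).
apply: (noncrossingP _ nc B1 B2 B1P B2P B12 y b c d) => //.
rewrite ltn_neqAle ymin ?(subsetP (partition_sub pP B2P)) // andbT.
by apply: contraNneq B12 => /val_inj yb; rewrite (partition_eq_block pP B1P B2P y1) ?yb.
Qed.

Let NCon_del P : P \in NCon (x |: D) -> joined P ->
  [set B :\ x | B : {set 'I_N} in P] \in NCon D.
Proof.
rewrite !inE => /andP[pP nc] jP; apply/andP; split.
  apply: partition_pointwise.
  - move=> _ /imsetP[B BP ->]; apply: contra_neq (partition_neq0 pP BP) => e.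
    by rewrite -(delxK pP jP BP) e /insx inE.
  - move=> z; apply: (iffP idP) => [zD|[_ /imsetP[B BP ->]]]; last first.
      rewrite !inE => /andP[zx zB]; move: (subsetP (partition_sub pP BP) _ zB).
      by rewrite !inE (negbTE zx).
    have [|B BP zB] := elimT (partition_coverP z pP); first by rewrite !inE zD orbT.
    exists (B :\ x); first exact: imset_f.
    by rewrite !inE zB andbT; apply: contraNneq xND => <-.
  - move=> _ _ z /imsetP[B1 B1P ->] /imsetP[B2 B2P ->]; rewrite !inE.
    move=> /andP[_ z1] /andP[_ z2].
    by rewrite (partition_eq_block pP B1P B2P z1 z2).
apply/noncrossingP => _ _ /imsetP[B1 B1P ->] /imsetP[B2 B2P ->] B12 a b c d.
have {}B12 : B1 != B2 by apply: contraNneq B12 => ->.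
rewrite !inE => /andP[_ a1] /andP[_ b2] /andP[_ c1] /andP[_ d2].
exact: (noncrossingP _ nc B1 B2 B1P B2P B12 a b c d).
Qed.

(** Deleting [x] is a bijection onto the noncrossing partitions of [D], with inverse [insx]. Only
    the block shared by [x] and [y] shrinks, which accounts for the successor in the argument of
    [f]. *)
Lemma sum_NCon_joined f g :
  \sum_(P in NCon (x |: D) | [exists B in P, (x \in B) && (y \in B)])
    \prod_(B in P) (if x \in B then f #|B| else g #|B|) =
  \sum_(P in NCon D) \prod_(B in P) (if y \in B then f #|B|.+1 else g #|B|).
Proof.
rewrite (reindex_onto (fun P : {set {set 'I_N}} => insx @: P)
   (fun P : {set {set 'I_N}} => [set B :\ x | B : {set 'I_N} in P])) /=; last first.
  move=> P /andP[]; rewrite inE => /andP[pP _] jP; rewrite -imset_comp.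
  rewrite -[RHS]imset_id; apply: eq_in_imset => B BP /=.
  exact: delxK pP jP BP.
have insxPK P : partition P D -> [set B :\ x | B : {set 'I_N} in insx @: P] = P.
  move=> pP; rewrite -imset_comp -[RHS]imset_id; apply: eq_in_imset => B BP /=.
  exact: insxK pP BP.
apply: eq_big => [P|P /andP[/andP[PN jP] /eqP e]].
  apply/andP/idP => [[/andP[PN jP] /eqP <-]|PN]; first exact: NCon_del.
  split; first exact: NCon_insx.
  by move: PN; rewrite inE => /andP[pP _]; rewrite insxPK.
have := NCon_del PN jP; rewrite e inE => /andP[pP _].
rewrite big_imset /=; last first.
  by move=> B1 B2 B1P B2P eB; rewrite -(insxK pP B1P) -(insxK pP B2P) eB.
apply: eq_bigr => B BP; rewrite mem_insx (negbTE (xNB pP BP)) eqxx /=.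
by rewrite /insx; case yB: (y \in B) => //=; rewrite cardsU1 (xNB pP BP).
Qed.

End Collapse.

Lemma NCon1 (N : nat) (x : 'I_N) : NCon [set x] = [set [set [set x]]].
Proof.
apply/setP => P; rewrite !inE; apply/andP/eqP => [[pP _]|->].
  apply/setP => B; rewrite inE; apply/idP/eqP => [BP|->].
    apply/eqP; rewrite eqEsubset (partition_sub pP BP) sub1set.
    have /set0Pn[z zB] := partition_neq0 pP BP.
    by have := subsetP (partition_sub pP BP) _ zB; rewrite inE => /eqP <-.
  have [|C CP xC] := elimT (partition_coverP x pP); first by rewrite inE.
  suff <- : C = [set x] by [].
  by apply/eqP; rewrite eqEsubset (partition_sub pP CP) sub1set.
split.
  apply: partition_pointwise => [B|z|B1 B2 z]; rewrite ?inE.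
  - by move=> /eqP ->; apply/set0Pn; exists x; rewrite inE.
  - apply: (iffP eqP) => [->|[B]]; first by exists [set x]; rewrite !inE.
    by rewrite inE => /eqP ->; rewrite inE => /eqP.
  - by move=> /eqP -> /eqP ->.
by apply/noncrossingP => B1 B2; rewrite !inE => /eqP -> /eqP ->; rewrite eqxx.
Qed.

(** * Recursion on the block of the least element *)

Definition NCsum N (D : {set 'I_N}) g : K :=
  \sum_(P in NCon D) \prod_(B in P) g #|B|.

(** The block of [x] has its own weight: in the application it is the one that carries a mixed
    cumulant. *)
Definition NCsum_first N (D : {set 'I_N}) (x : 'I_N) f g : K :=
  \sum_(P in NCon D) \prod_(B in P) (if x \in B then f #|B| else g #|B|).

Lemma NCsum_firstE N (D : {set 'I_N}) x g : NCsum_first D x g g = NCsum D g.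
Proof. by apply: eq_bigr => P _; apply: eq_bigr => B _; case: ifP. Qed.

(* Classify the partitions by the element [y] that follows the least element [x]
   in its block: the elements strictly between [x] and [y] are partitioned on
   their own, and [x] can be deleted from the rest. *)
Lemma NCsum_first_rec N (D : {set 'I_N}) (x : 'I_N) f g :
  x \in D -> (forall z, z \in D -> (x <= z)%N) ->
  NCsum_first D x f g = f 1%N * NCsum (D :\ x) g +
    \sum_(y in D :\ x) NCsum [set z in D | (x < z < y)%N] g *
       NCsum_first [set z in D | (y <= z)%N] y (fun k => f k.+1) g.
Proof.
move=> xD xmin.
(* The element after [x] in its block; the default value [x] encodes a singleton block. *)
pose nx (P : {set {set 'I_N}}) : 'I_N := odflt x
  [pick y in pblock P x :\ x | [forall z in pblock P x :\ x, (y <= z)%N]].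
have blockx P : P \in NCon D -> pblock P x \in P /\ x \in pblock P x.
  rewrite inE => /andP[pP _].
  by rewrite mem_pblock pblock_mem (cover_partition pP).
have nxP P y : P \in NCon D -> y != x ->
    reflect (y \in pblock P x /\ forall z, z \in pblock P x :\ x -> (y <= z)%N)
            (nx P == y).
  move=> PN yx; rewrite /nx; case: pickP => /= [u|no].
    move=> /andP[uB /forall_inP umin]; apply: (iffP eqP) => [<-|[yB ymin]].
      by split=> //; move: uB; rewrite inE => /andP[].
    apply/val_inj/eqP; rewrite eqn_leq umin ?ymin //.
    by rewrite !inE yx.
  apply: (iffP eqP) => [xy|[yB ymin]]; first by rewrite xy eqxx in yx.
  move: (no y); rewrite !inE yx yB /= => /negP[].
  by apply/forall_inP => z; exact: ymin.
have nxx P : P \in NCon D -> (nx P == x) = (pblock P x == [set x]).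
  move=> PN; have [_ xB] := blockx _ PN.
  apply/idP/idP => [|/eqP e]; last first.
    by rewrite /nx e; case: pickP => //= u; rewrite !inE andNb.
  apply: contraTT => neq.
  have /set0Pn[u uB] : pblock P x :\ x != set0.
    by apply: contraNneq neq => e; rewrite -(setD1K xB) e setU0.
  case: (arg_minnP (fun z : 'I_N => (z : nat)) uB) => v vB vmin.
  have /andP[vx vB'] : (v != x) && (v \in pblock P x) by move: (vB : v \in _ :\
    _); rewrite !inE.
  have /eqP -> // : nx P == v by apply/nxP.
rewrite /NCsum_first (partition_big nx (mem D)) /=; last first.
  move=> P PN; have [BP xB] := blockx _ PN.
  case: (eqVneq (nx P) x) => [->|nxx'] //.
  have [+ _] := elimT (nxP _ _ PN nxx') (eqxx _).
  by move: PN; rewrite inE => /andP[pP _]; apply/subsetP/(partition_sub pP BP).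
(* The class [nx P = x] consists of the partitions with block [[set x]], which contributes [f 1]. *)
rewrite (bigD1 x xD) /=; congr (_ + _).
  have dx : [disjoint [set x] & D :\ x].
    by rewrite disjoints1 !inE eqxx.
  have eD : [set x] :|: D :\ x = D by rewrite setD1K.
  transitivity (\sum_(P in NCon ([set x] :|: D :\ x) |
      [forall B in P, (B \subset [set x]) || (B \subset D :\ x)] && true)
      \prod_(B in P) (if x \in B then f #|B| else g #|B|)).
    rewrite eD; apply: eq_bigl => P; rewrite andbT; case PN : (P \in NCon D) => //=.
    have [BP xB] := blockx _ PN.
    have pP : partition P D by move: PN; rewrite inE => /andP[].
    rewrite nxx //; apply/eqP/forall_inP => [e B BP'|sP].
      case: (eqVneq B [set x]) => [->|Bx]; first by rewrite subxx.
      rewrite subsetD1 (partition_sub pP BP') /=.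
      have -> : x \notin B; last by rewrite orbT.
      apply: contraNN Bx => xB'.
      by rewrite (partition_eq_block pP BP' BP xB' xB) e.
    apply/eqP; rewrite eqEsubset sub1set xB andbT.
    case/orP: (sP _ BP) => // /subsetP /(_ x xB).
    by rewrite !inE eqxx.
  rewrite (sum_NConU (fun=> true)) //; last first.
    by move=> a b c; rewrite !inE => /eqP -> /eqP -> _ /ltn_trans h /h; rewrite ltnn.
  rewrite NCon1 big_set1 big_set1 inE eqxx cards1; congr (_ * _).
  apply: eq_big => [P|P /andP[]]; rewrite ?andbT // => PN _.
  move: PN; rewrite inE => /andP[pP _].
  apply: eq_bigr => B BP; case: ifP => // xB.
  by have := subsetP (partition_sub pP BP) _ xB; rewrite !inE eqxx.
apply: eq_big => [y|y /andP[yD yx]]; first by rewrite !inE andbC.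
have xy : (x < y)%N by rewrite ltn_neqAle xmin // andbT eq_sym.
set D1 := [set z in D | (x < z < y)%N]; set D2 := [set z in D | (y <= z)%N].
have dD : [disjoint D1 & x |: D2].
  rewrite disjoint_subset; apply/subsetP => z; rewrite !inE.
  move=> /and3P[zD xz zy]; rewrite zD negb_or -ltnNge zy andbT.
  by apply: contraTneq xz => ->; rewrite ltnn.
have eD : D1 :|: (x |: D2) = D.
  apply/setP => z; rewrite !inE; case: (eqVneq z x) => [->|zx] /=.
    by rewrite orbT xD.
  case zD : (z \in D) => //=.
  have -> : (x < z)%N by rewrite ltn_neqAle xmin // andbT eq_sym.
  by rewrite ltnNge orNb.
have joinedP P : [exists B in P ::&: (x |: D2), (x \in B) && (y \in B)] =
    [exists B in P, [&& B \subset x |: D2, x \in B & y \in B]].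
  apply/exists_inP/exists_inP => [[B]|[B BP /andP[s h]]].
    by rewrite inE => /andP[BP s] h; exists B; rewrite ?s.
  by exists B; rewrite // inE BP.
transitivity (\sum_(P in NCon (D1 :|: (x |: D2)) |
    [forall B in P, (B \subset D1) || (B \subset x |: D2)] &&
    [exists B in P ::&: (x |: D2), (x \in B) && (y \in B)])
    \prod_(B in P) (if x \in B then f #|B| else g #|B|)).
  rewrite eD; apply: eq_bigl => P; case PN : (P \in NCon D) => //=.
  have [BP xB] := blockx _ PN.
  have [pP nc] : partition P D /\ noncrossing P.
    by move: PN; rewrite inE => /andP[].
  rewrite joinedP; apply/nxP/andP => // [[yB ymin]|[/forall_inP sP]].
    have sE : pblock P x \subset x |: D2.
      apply/subsetP => z zB; rewrite !inE; case: (eqVneq z x) => //= zx.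
      by rewrite (subsetP (partition_sub pP BP)) //= ymin // !inE zx.
    split; last by apply/exists_inP; exists (pblock P x); rewrite // sE xB yB.
    apply/forall_inP => B BP'.
    case: (eqVneq B (pblock P x)) => [->|nB]; first by rewrite sE orbT.
    have xNB : x \notin B.
      by apply: contraNN nB => xB'; rewrite (partition_eq_block pP BP' BP xB' xB).
    have yNB : y \notin B.
      by apply: contraNN nB => yB'; rewrite (partition_eq_block pP BP' BP yB' yB).
    have BD := subsetP (partition_sub pP BP').
    have gtx z : z \in B -> (x < z)%N.
      move=> zB; rewrite ltn_neqAle xmin ?BD // andbT.
      by apply: contraNneq xNB => /val_inj ->.
    (* A block meeting both the gap and the rest would cross the block of [x] through
       [x < b < y < d]. *)
    apply/norP => -[/subsetPn[d dB dD1] /subsetPn[b bB bD2]].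
    move: dD1 bD2; rewrite !inE !BD ?gtx //= negb_or -!leqNgt -ltnNge => yd
      /andP[_ by'].
    have {}yd : (y < d)%N.
      by rewrite ltn_neqAle yd andbT; apply: contraNneq yNB => /val_inj ->.
    rewrite eq_sym in nB.
    exact: (noncrossingP _ nc _ _ BP BP' nB x b y d xB bB yB dB (gtx _ bB) by' yd).
  move=> /exists_inP[B BP' /and3P[sE xB' yB]].
  rewrite (partition_eq_block pP BP BP' xB xB'); split=> // z.
  rewrite !inE => /andP[zx zB]; have := subsetP sE _ zB.
  by rewrite !inE (negbTE zx) => /andP[].
rewrite (sum_NConU (fun P => [exists B in P, (x \in B) && (y \in B)])) //; last first.
  move=> a b c; rewrite !inE => /and3P[aD xa ay] /and3P[cD xc cy].
  case/orP => [/eqP ->|/andP[bD yb]] ab bc.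
    by have := ltn_trans xa ab; rewrite ltnn.
  by have := leq_ltn_trans yb (ltn_trans bc cy); rewrite ltnn.
congr (_ * _).
  apply: eq_bigr => P; rewrite inE => /andP[pP _]; apply: eq_bigr => B BP.
  case: ifP => // xB; have := subsetP (partition_sub pP BP) _ xB.
  by rewrite !inE ltnn andbF.
rewrite sum_NCon_joined // => [z| |z].
- by rewrite inE => /andP[_]; exact: leq_trans.
- by rewrite inE leqnn andbT.
- by rewrite inE => /andP[].
Qed.


(** Ranks enumerate [0, ..., #|E| - 1], by induction on removal of the largest element. A sum over
    the successor [y] thus becomes a sum over the size of the gap before it. *)
Lemma sum_rank (N : nat) (E : {set 'I_N}) (F : nat -> K) :
  \sum_(y in E) F #|[set z in E | (z < y)%N]| = \sum_(j < #|E|) F j.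
Proof.
elim: {E}#|E| {-2}E (erefl #|E|) => [|n IH] E cE.
  rewrite cE big_ord0 big_pred0 // => y.
  by move/eqP: cE; rewrite cards_eq0 => /eqP ->; rewrite inE.
have /set0Pn[v0 v0E] : E != set0 by rewrite -card_gt0 cE.
case: (arg_maxnP (fun z : 'I_N => (z : nat)) v0E) => v vE vmax.
have {}vE : v \in E := vE.
have {}vmax z : z \in E -> (z <= v)%N := vmax z.
have cE' : #|E :\ v| = n by move: cE; rewrite (cardsD1 v) vE => -[].
rewrite cE big_ord_recr /= (bigD1 v vE) /= addrC; congr (_ + F _).
  rewrite -[in RHS]cE' -(IH _ cE'); apply: eq_big => [y|y /andP[yE yv]].
    by rewrite !inE andbC.
  congr (F _); apply: eq_card => z; rewrite !inE.
  case: (eqVneq z v) => [->|//] /=.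
  by rewrite ltnNge (vmax y yE) andbF.
rewrite -cE'; apply: eq_card => z; rewrite !inE andbC.
case zE : (z \in E); rewrite ?andbF // !andbT.
by rewrite ltn_neqAle (vmax z zE) andbT.
Qed.

Definition NCmoment g n : K := NCsum [set: 'I_n] g.

Definition NCmoment_first f g n : K := NCsum_first [set: 'I_n.+1] ord0 f g.

Lemma NCsum_set0 (N : nat) g : NCsum (set0 : {set 'I_N}) g = 1.
Proof.
rewrite /NCsum (big_pred1 set0) ?big_set0 // => P; rewrite inE partition_set0.
apply/andP/eqP => [[/eqP]//|->]; split=> //.
by apply/noncrossingP => B1 B2; rewrite inE.
Qed.

(** Here [j] is the size of the gap between the first two points of the first block. The truncation
    in [n.-1] is harmless, as the sum is empty for [n = 0]. *)
Let NCmoment_first_rhs f g n : K :=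
  f 1%N * NCmoment g n +
  \sum_(j < n) NCmoment g j * NCmoment_first (fun k => f k.+1) g (n.-1 - j).

Let NCsum_card_step g n :
  (forall k, (k <= n)%N -> forall N (D : {set 'I_N}), #|D| = k ->
     NCsum D g = NCmoment g k) ->
  (forall k, (k < n)%N -> forall f N (D : {set 'I_N}) x, #|D| = k.+1 ->
     x \in D -> (forall z, z \in D -> (x <= z)%N) ->
     NCsum_first D x f g = NCmoment_first f g k) ->
  forall f N (D : {set 'I_N}) x, #|D| = n.+1 ->
     x \in D -> (forall z, z \in D -> (x <= z)%N) ->
     NCsum_first D x f g = NCmoment_first_rhs f g n.
Proof.
move=> H1 H2 f N D x cD xD xmin; rewrite NCsum_first_rec //.
have cE : #|D :\ x| = n by move: cD; rewrite (cardsD1 x) xD => -[].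
rewrite (H1 n) //; congr (_ + _).
have := sum_rank (D :\ x) (fun j => NCmoment g j *
  NCmoment_first (fun k => f k.+1) g (n.-1 - j)); rewrite cE => <-.
apply: eq_bigr => y yE; have [yx yD] := setD1P yE.
have xlt z : z \in D -> (x < z)%N = (z != x).
  by move=> zD; rewrite ltn_neqAle xmin // andbT eq_sym.
set r := #|[set z in _ | _]|.
have rn : (r < n)%N.
  rewrite -cE; apply: proper_card; apply/properP; split.
    by apply/subsetP => z; rewrite inE => /andP[].
  by exists y; rewrite // inE ltnn andbF.
have c1 : #|[set z in D | (x < z < y)%N]| = r.
  apply: eq_card => z; rewrite !inE; case zD : (z \in D); rewrite ?andbF //=.
  by rewrite xlt // andbT.
have c2 : #|[set z in D | (y <= z)%N]| = (n.-1 - r).+1.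
  have : #|[set z in D :\ x | (z < y)%N] :|: [set z in D | (y <= z)%N]| = n.
    rewrite -cE; apply: eq_card => z; rewrite !inE.
    case zD : (z \in D); rewrite ?andbF //= andbT.
    case: (eqVneq z x) => [->|_] /=; last by rewrite ltnNge orNb.
    by rewrite leqNgt xlt // yx.
  rewrite cardsU (_ : _ :&: _ = set0) ?cards0 ?subn0; last first.
    by apply/setP => z; rewrite !inE ltnNge; case: (y <= z)%N; rewrite ?andbF.
  rewrite -/r => <-; case: #|[set z in D | _]| (cardsD1 y [set z in D | (y <=
    z)%N]) => [|m _].
    by rewrite inE yD leqnn.
  by rewrite addnS /= addKn.
rewrite (H1 r) 1?ltnW // (H2 (n.-1 - r)%N) ?inE ?yD //.
- by rewrite (leq_ltn_trans (leq_subr _ _)) // ltn_predL (leq_ltn_trans _ rn).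
- by rewrite leqnn.
- by move=> z; rewrite inE => /andP[].
Qed.

(** Only the order type of the ground set matters. No order isomorphism is built: by strong
    induction, all sets of a given size obey the same recursion. *)
Lemma NCsum_card g n :
  (forall N (D : {set 'I_N}), #|D| = n -> NCsum D g = NCmoment g n) /\
  (forall f N (D : {set 'I_N}) x, #|D| = n.+1 ->
     x \in D -> (forall z, z \in D -> (x <= z)%N) ->
     NCsum_first D x f g = NCmoment_first f g n).
Proof.
have [m] := ubnP n; elim: m n => // m IH n; rewrite ltnS => nm.
have P1 N (D : {set 'I_N}) : #|D| = n -> NCsum D g = NCmoment g n.
  case: n nm => [|n] nm cD.
    move/eqP: cD; rewrite cards_eq0 => /eqP ->; rewrite /NCmoment !NCsum_set0.
    by rewrite (_ : [set: 'I_0] = set0) ?NCsum_set0 //; apply/setP => -[].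
  have /set0Pn[v0 v0D] : D != set0 by rewrite -card_gt0 cD.
  case: (arg_minnP (fun z : 'I_N => (z : nat)) v0D) => v vD vmin.
  rewrite -(NCsum_firstE _ v) /NCmoment -(NCsum_firstE _ ord0).
  by rewrite (IH n nm).2.
have H1 k : (k <= n)%N -> forall N (D : {set 'I_N}), #|D| = k ->
    NCsum D g = NCmoment g k.
  rewrite leq_eqVlt => /orP[/eqP -> //|kn]; exact: (IH k (leq_trans kn nm)).1.
have H2 k : (k < n)%N -> forall f N (D : {set 'I_N}) x, #|D| = k.+1 ->
     x \in D -> (forall z, z \in D -> (x <= z)%N) ->
     NCsum_first D x f g = NCmoment_first f g k.
  by move=> kn; exact: (IH k (leq_trans kn nm)).2.
split=> // f N D x cD xD xmin; rewrite (NCsum_card_step H1 H2 f cD) //.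
by rewrite /NCmoment_first (NCsum_card_step H1 H2) ?cardsT ?card_ord // inE.
Qed.

Lemma NCmoment_firstE f g n : NCmoment_first f g n = f 1%N * NCmoment g n +
  \sum_(j < n) NCmoment g j * NCmoment_first (fun k => f k.+1) g (n.-1 - j).
Proof.
rewrite /NCmoment_first (@NCsum_card_step g n) ?cardsT ?card_ord ?inE //.
- by move=> k _; exact: (NCsum_card g k).1.
- by move=> k _; exact: (NCsum_card g k).2.
Qed.

Lemma NCmoment0 g : NCmoment g 0 = 1.
Proof.
by rewrite /NCmoment (_ : [set: 'I_0] = set0) ?NCsum_set0 //; apply/setP => -[].
Qed.

Lemma NCmomentS g n : NCmoment g n.+1 = NCmoment_first g g n.
Proof. by rewrite /NCmoment_first NCsum_firstE. Qed.

(* Generating-function form: the block of the first element has [k.+1] elements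
   and leaves [k.+1] gaps, each filled by a noncrossing partition. *)
Lemma NCmoment_first_coef f g n N (M : {poly K}) : (n <= N)%N ->
  (forall i, (i <= N)%N -> M`_i = NCmoment g i) ->
  NCmoment_first f g n = \sum_(k < n.+1) f k.+1 * (M ^+ k.+1)`_(n - k).
Proof.
move=> nN HM; have [m] := ubnP n; elim: m n nN f => // m IH n nN f; rewrite ltnS => nm.
rewrite NCmoment_firstE big_ord_recl subn0 expr1 HM //; congr (_ + _).
case: n nN nm => [|n] nN nm; first by rewrite !big_ord0.
under eq_bigr => j _.
  rewrite (IH (n - j)%N) ?(leq_trans (leq_subr _ _) (ltnW nN)) //; last first.
    exact: leq_ltn_trans (leq_subr _ _) nm.
  rewrite mulr_sumr.
  rewrite (eq_bigr (fun k : 'I_(n - j).+1 =>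
     f k.+2 * (NCmoment g j * (M ^+ k.+1)`_(n - j - k)))); last first.
    by move=> k _; rewrite mulrCA.
  rewrite (big_ord_widen_cond n.+1 predT (fun k => f k.+2 *
     (NCmoment g j * (M ^+ k.+1)`_(n - j - k)))) ?ltnS ?leq_subr //.
  rewrite big_mkcond /=.
  over.
(* After the exchange, the sum over [j] is a coefficient of the product [M * M ^+ k.+1]. *)
rewrite exchange_big /=; apply: eq_bigr => k _.
rewrite (_ : bump 0 k = k.+1) // subSS [M ^+ k.+2]exprS coefM mulr_sumr.
rewrite [RHS](big_ord_widen n.+1 (fun j => f k.+2 * (M`_j * (M ^+ k.+1)`_(n - k
  - j)))) ?ltnS ?leq_subr //.
rewrite [RHS]big_mkcond /=; apply: eq_bigr => j _.
have -> : (k < (n - j).+1)%N = (j < (n - k).+1)%N.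
  by rewrite [LHS]ltnS [RHS]ltnS !leq_subRL 1?addnC ?leq_ord.
case: ifP => // _; rewrite HM; last exact: leq_trans (leq_ord j) (ltnW nN).
by rewrite subnAC.
Qed.

End NoncrossingSums.

(** * Moments as noncrossing sums of free cumulants *)

Section FreeCumulantMoments.
Variables (C : comNzRingType) (A : nzRingType) (phi : A -> C).

Lemma enum_ord0 (m : nat) (B : {set 'I_m.+1}) :
  ord0 \in B -> enum B = ord0 :: enum (B :\ ord0).
Proof.
move=> B0; have e (D : {set 'I_m.+1}) : enum D = [seq x <- enum 'I_m.+1 | x \in D].
  by rewrite [in RHS]enumT.
rewrite [LHS]e [X in _ :: X]e enum_ordSl /= B0 !inE eqxx /=; congr (_ :: _).
by apply: eq_in_filter => i /mapP[j _ ->]; rewrite !inE.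
Qed.

Lemma block_args_nseq_tail (x y : A) (n : nat)
    (B : {set 'I_(size (x :: nseq n y))}) :
  ord0 \notin B -> block_args B = nseq #|B| y.
Proof.
move=> B0; rewrite -(size_block_args (s := x :: nseq n y)).
apply/all_pred1P/allP => _ /mapP[i iB ->] /=.
have iB' : i \in B by rewrite -mem_enum.
have i0 : (0 < i)%N.
  by rewrite lt0n; apply: contraNneq B0 => e; rewrite (_ : ord0 = i) //; exact: val_inj.
have : (nat_of_ord i < n.+1)%N by rewrite -{2}(size_nseq n y) ltn_ord.
move: (nat_of_ord i) i0 => [|j] //= _; rewrite ltnS => jn.
by rewrite nth_nseq jn.
Qed.

Lemma block_args_nseq_head (x y : A) (n : nat)
    (B : {set 'I_(size (x :: nseq n y))}) :
  ord0 \in B -> block_args B = x :: nseq #|B|.-1 y.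
Proof.
move=> B0; have := @block_args_nseq_tail x y n (B :\ ord0).
rewrite /block_args (enum_ord0 B0) /= !inE eqxx /= => -> //.
by rewrite (cardsD1 ord0 B) B0.
Qed.

Lemma prodr_nseq (x : A) (n : nat) : \prod_(y <- nseq n x) y = x ^+ n.
Proof. by rewrite big_nseq; elim: n => //= n ->; rewrite exprS. Qed.

(** In the moment-cumulant formula for [x, y, ..., y], the block of the first index reads
    [x, y, ..., y] and every other block reads [y, ..., y], so each weight depends only on the size
    of the block. *)
Lemma moment_first_NC (x y : A) (n : nat) :
  phi (x * y ^+ n) = NCmoment_first
    (fun k => free_cumulant phi (x :: nseq k.-1 y))
    (fun k => free_cumulant phi (nseq k y)) n.
Proof.
have := @free_cumulantP _ _ phi (x :: nseq n y) isT.
rewrite big_cons prodr_nseq => ->.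
set f := (X in NCmoment_first X); set g := (X in NCmoment_first f X).
rewrite -((NCsum_card g n).2 f _ [set: 'I_(size (x :: nseq n y))] (@ord0 (size
  (nseq n y)))) ?inE //.
  apply: eq_bigr => P _; apply: eq_bigr => B _.
  case: ifPn => B0; first by rewrite block_args_nseq_head.
  by rewrite block_args_nseq_tail.
by rewrite cardsT card_ord /= size_nseq.
Qed.

Lemma moment_NC (y : A) (n : nat) : phi 1 = 1 ->
  phi (y ^+ n) = NCmoment (fun k => free_cumulant phi (nseq k y)) n.
Proof.
move=> phi1; case: n => [|n]; first by rewrite expr0 NCmoment0.
rewrite exprS moment_first_NC NCmomentS -[RHS]/(NCsum_first _ _ _ _).
apply: eq_bigr => P; rewrite inE => /andP[pP _]; apply: eq_bigr => B BP.
(* The two weights agree only on positive sizes, and blocks are nonempty. *)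
have : (0 < #|B|)%N by rewrite card_gt0 (partition_neq0 pP BP).
by case: #|B|.
Qed.

(* With [M] the (truncated) moment series of [y], this is
   [\sum_n phi(x y^n) z^n = \sum_k R_(k+1)(x, y, .., y) z^k M^(k+1)]. *)
Lemma moment_first_coef (x y : A) (n N : nat) (M : {poly C}) : phi 1 = 1 ->
  (n <= N)%N -> (forall i, (i <= N)%N -> M`_i = phi (y ^+ i)) ->
  phi (x * y ^+ n) =
  \sum_(k < n.+1) free_cumulant phi (x :: nseq k y) * (M ^+ k.+1)`_(n - k).
Proof.
move=> phi1 nN HM; rewrite moment_first_NC (NCmoment_first_coef _ nN (M := M)) //.
by move=> i /HM ->; exact: moment_NC.
Qed.

End FreeCumulantMoments.

(** * Moment and cumulant series *)

Section TruncatedSeries.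
Variable F : numFieldType.
Implicit Types (p q S Q G W : {poly F}) (r : F).

Lemma dvdXnP (n : nat) p : reflect (forall i, (i < n)%N -> p`_i = 0) ('X^n %| p).
Proof.
apply: (iffP idP) => [/dvdpP[q ->] i lin|H]; first by rewrite coefMXn lin.
rewrite -(poly_take_drop n p) (_ : take_poly n p = 0) ?add0r ?dvdp_mull //.
by apply/polyP => i; rewrite coef_take_poly coef0; case: ifP => // /H.
Qed.

(* Differentiating [S ^ 2 = Q] gives the linear equation [2 Q S' = Q' S]. *)
Lemma sqrt_deriv_mod (n : nat) S Q : 'X^(n.+1) %| S ^+ 2 - Q ->
  'X^n %| Q * S^`() *+ 2 - Q^`() * S.
Proof.
move=> /dvdpP[E H]; have eQ : Q = S ^+ 2 - E * 'X^(n.+1) by rewrite -H; ring.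
apply/dvdpP; exists (E^`() * 'X * S + E *+ n.+1 * S - E * S^`() * 'X *+ 2).
rewrite eQ !derivE /= (exprS 'X n) -[E *+ _]mulr_natr -['X^n *+ _]mulr_natr; ring.
Qed.

(** If the lowest term of [G] had degree [i < n], then [G \Po W] would start in degree [i] with that
    coefficient times the [i]-th power of the nonzero linear coefficient of [W]. This is used to
    undo the substitution [w = zM]. *)
Lemma dvdXn_comp (n : nat) G W : W`_0 = 0 -> W`_1 != 0 ->
  'X^n %| G \Po W -> 'X^n %| G.
Proof.
move=> W0 W1 /dvdXnP H; apply/dvdXnP.
have [V eW] : exists V, W = V * 'X.
  exists (drop_poly 1 W); rewrite -{1}(poly_take_drop 1 W) expr1.
  rewrite (_ : take_poly 1 W = 0) ?add0r //.
  by apply/polyP => -[|i]; rewrite coef_take_poly coef0.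
have V0 : V`_0 != 0 by move: W1; rewrite eW coefMX.
elim/ltn_ind => i IH lin.
have [G' eG] : exists G', G = G' * 'X^i.
  by apply/dvdpP/dvdXnP => j ji; apply: IH => //; exact: ltn_trans lin.
rewrite eG coefMXn ltnn subnn; apply/eqP.
have := H i lin; rewrite eG comp_polyM comp_Xn_poly {2}eW exprMn mulrA.
rewrite coefMXn ltnn subnn coef0M -!horner_coef0 horner_exp horner_comp.
rewrite [W.[0]]horner_coef0 W0 => /eqP.
by rewrite mulf_eq0 expf_eq0 horner_coef0 (horner_coef0 V) (negbTE V0) andbF
  orbF -horner_coef0.
Qed.

End TruncatedSeries.

(* [m], [R] are the moments and cumulants of X^-1 and [r] is the first cumulant of
   X: with [M], [R] also denoting the generating series, [mS] says
   [M = 1 + R(zM)] and [mX] says [r + zM = rM - M R(zM)]. *)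
Section MomentSeries.
Variables (F : numFieldType) (m R : nat -> F) (r : F).
Hypothesis m0 : m 0 = 1.
Hypothesis mS : forall (n : nat) (M : {poly F}),
  (forall i, (i <= n)%N -> M`_i = m i) ->
  m n.+1 = \sum_(k < n.+1) R k.+1 * (M ^+ k.+1)`_(n - k).
Hypothesis mX : forall (n : nat) (M : {poly F}),
  (forall i, (i <= n)%N -> M`_i = m i) ->
  (if n is n'.+1 then m n' else r) =
  r * M`_n - \sum_(k < n) R k.+1 * (M ^+ k.+2)`_(n - k.+1).

(** Truncations of the series M and R; identities between them hold modulo ['X^(N.+1)]. *)
Let Mp N : {poly F} := \poly_(i < N.+1) m i.
Let Gp N : {poly F} := \sum_(k < N) R k.+1 *: 'X^(k.+1).

Let coefMp N i : (i <= N)%N -> (Mp N)`_i = m i.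
Proof. by rewrite coef_poly ltnS => ->. Qed.

Let coefGp N i : (Gp N)`_i = if (0 < i <= N)%N then R i else 0.
Proof.
rewrite coef_sum; case: i => [|i] /=.
  by rewrite big1 // => k _; rewrite coefZ coefXn mulr0.
case: ifPn => [iN|iN].
  rewrite (bigD1 (Ordinal iN)) //= coefZ coefXn eqxx mulr1 big1 ?addr0 // => k neq.
  rewrite coefZ coefXn eqSS; case: eqP => [e|]; rewrite ?mulr0 //.
  by case/eqP: neq; apply: val_inj; rewrite /= e.
rewrite big1 // => k _; rewrite coefZ coefXn eqSS; case: eqP => e; rewrite ?mulr0 //.
by rewrite e ltn_ord in iN.
Qed.

(** The coefficients of [M^j R(zM)]: the case [j = 0] serves [mS] and the case [j = 1] serves
    [mX]. *)
Let sum_comp N n (j : nat) : (n <= N)%N -> ((Mp N) ^+ j * (Gp N \Po ('X * Mp N)))`_n =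
  \sum_(k < n) R k.+1 * ((Mp N) ^+ (j + k.+1))`_(n - k.+1).
Proof.
move=> nN; rewrite /Gp (raddf_sum (comp_poly _)) mulr_sumr coef_sum.
rewrite (big_ord_widen _ (fun k => R k.+1 * ((Mp N) ^+ (j + k.+1))`_(n - k.+1)) nN).
rewrite [RHS]big_mkcond; apply: eq_bigr => k _.
rewrite /= linearZ /= comp_Xn_poly -scalerAr coefZ exprMn mulrCA -exprD coefXnM.
by rewrite ltnS; case: ltnP; rewrite ?mulr0.
Qed.

Let moment_eq N : 'X^(N.+1) %| Mp N - 1 - (Gp N \Po ('X * Mp N)).
Proof.
apply/dvdXnP => -[|n] iN; rewrite !coefB coef1 coefMp //.
  by have := @sum_comp N 0 0 isT; rewrite expr0 mul1r big_ord0 => ->;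
    rewrite m0 subrr subr0.
have := @sum_comp N n.+1 0 iN; rewrite expr0 mul1r => ->.
rewrite /= subr0 (@mS n (Mp N)) ?subrr //.
by move=> i ni; rewrite coefMp // (leq_trans ni) // ltnW.
Qed.

Let mixed_eq N :
  'X^(N.+1) %| r *: Mp N - Mp N * (Gp N \Po ('X * Mp N)) - r%:P - 'X * Mp N.
Proof.
apply/dvdXnP => n iN; rewrite !coefB coefZ coefC coefXM.
have := @sum_comp N n 1 iN; rewrite expr1 => ->.
rewrite -mX => [|i ni]; last by rewrite coefMp // (leq_trans ni).
by case: n iN => [|n] iN /=; rewrite ?subr0 ?subrr // coefMp ?subrr // ltnW.
Qed.

Let c := r - 1.

(** Multiplying [M = 1 + R(zM)] by [M] and subtracting the mixed equation cancels the term
    [M R(zM)]. *)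
Let M_eq N : 'X^(N.+1) %| Mp N ^+ 2 - ((1 + r)%:P - 'X) * Mp N + r%:P.
Proof.
rewrite (_ : _ + _ = Mp N * (Mp N - 1 - (Gp N \Po ('X * Mp N))) -
  (r *: Mp N - Mp N * (Gp N \Po ('X * Mp N)) - r%:P - 'X * Mp N)).
  by rewrite dvdp_sub // dvdp_mull.
by rewrite -mul_polyC rmorphD rmorph1; ring.
Qed.

(** With [W = R(zM)], putting [M = 1 + W] in the quadratic equation gives [W^2 - c W + zM = 0].
    Every term is now a function of [zM], and [dvdXn_comp] removes the substitution. *)
Let G_eq N : 'X^(N.+1) %| Gp N ^+ 2 - c%:P * Gp N + 'X.
Proof.
apply: (@dvdXn_comp _ _ _ ('X * Mp N)); first by rewrite coefXM.
  by rewrite coefXM /= coefMp ?m0 ?oner_neq0.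
rewrite expr2 comp_polyD comp_polyB !comp_polyM comp_polyC comp_polyX.
set W := _ \Po _.
rewrite (_ : _ + _ = (Mp N ^+ 2 - ((1 + r)%:P - 'X) * Mp N + r%:P) -
   (Mp N - 1 - W) * (Mp N + W - r%:P)).
  by rewrite dvdp_sub // dvdp_mulr.
by rewrite /c !rmorphD rmorphN rmorph1; ring.
Qed.

(** Completing the square in [M_eq], the series [S = 1 + r - z - 2M] satisfies
    [S^2 = c^2 - 2 (r + 1) z + z^2]; the recursion is a coefficient of [2 Q S' = Q' S]. *)
Lemma moment_rec n : (0 < n)%N ->
  n.+1%:R * c ^+ 2 * m n.+1 =
  (2 * n%:R - 1) * (r + 1) * m n - (n%:R - 2) * m n.-1.
Proof.
case: n => // n _; pose N := n.+4.
have [S [sS dS]] : exists S : {poly F},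
    (forall i, (i <= N)%N ->
       S`_i = (i == 0)%:R * (1 + r) - (i == 1)%:R - 2 * m i) /\
    'X^(N.+1) %| S ^+ 2 - ((c ^+ 2)%:P - 'X * (2 * (r + 1))%:P + 'X * 'X).
  exists ((1 + r)%:P - 'X - Mp N *+ 2); split=> [i iN|].
    rewrite !coefB coefC coefX coefMn coefMp //.
    by case: i iN => [|i] _ /=; ring.
  rewrite (_ : _ - _ = (Mp N ^+ 2 - ((1 + r)%:P - 'X) * Mp N + r%:P) *+ 4).
    by rewrite -mulr_natr dvdp_mulr.
  by rewrite /c !(rmorphXn, rmorphM, rmorphD, rmorphN) /= !rmorph1; ring.
have /dvdXnP /(_ n.+1) := sqrt_deriv_mod dS.
rewrite !derivE /= (_ : _ - _ = (c ^+ 2 * 2)%:P * S^`()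
   - 'X * ((4 * (r + 1))%:P * S^`()) + 'X * ('X * (2%:P * S^`()))
   + (2 * (r + 1))%:P * S - 'X * (2%:P * S)); last first.
  by rewrite /c !(rmorphXn, rmorphM, rmorphD, rmorphN) /= !rmorph1; ring.
rewrite !(coefD, coefB, coefN, coefCM, coefXM, coef_deriv) /=.
have [n1N n2N] : (n.+1 < N)%N /\ (n.+2 <= N)%N by rewrite /N; lia.
move=> /(_ n1N); rewrite !sS //; try by rewrite /N; lia.
move=> H; apply/eqP; rewrite -subr_eq0; apply/eqP.
rewrite -[RHS](mulr0 (- (4^-1))) -{}H.
(* The coefficients of [S] in degrees 0 and 1 have extra terms, so the smallest cases are computed
   separately. *)
case: n @N n1N n2N sS dS => [|n] N n1N n2N sS dS /=.
  by rewrite m0; field.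
case: n @N n1N n2N sS dS => [|n] N n1N n2N sS dS /=; by field.
Qed.

(** The coefficient of degree one in [R^2 - c R + w = 0], to which [R^2] does not contribute since
    [R] has no constant term. It also shows that [c] is nonzero. *)
Lemma cumulant1 : c * R 1 = 1.
Proof.
have /dvdXnP /(_ 1 isT) := G_eq 1.
rewrite coefD coefB coefX coefCM expr2 coefM 2!big_ord_recr big_ord0 /= !coefGp /=.
rewrite mul0r mulr0 !add0r => H; apply/eqP.
by rewrite -subr_eq0 -oppr_eq0; apply/eqP; rewrite -[RHS]H; ring.
Qed.

(** The same device as for the moments, now with [S = c - 2R] and [S^2 = c^2 - 4w]. *)
Lemma cumulant_rec n : (0 < n)%N ->
  n.+1%:R * c ^+ 2 * R n.+1 = (4 * n%:R - 2) * R n.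
Proof.
case: n => // n _; pose N := n.+4.
pose S := c%:P - Gp N *+ 2.
have dS : 'X^(N.+1) %| S ^+ 2 - ((c ^+ 2)%:P - 'X *+ 4).
  rewrite (_ : _ - _ = (Gp N ^+ 2 - c%:P * Gp N + 'X) *+ 4).
    by rewrite -mulr_natr dvdp_mulr.
  by rewrite /S !rmorphXn /=; ring.
have sS i : (0 < i <= N)%N -> S`_i = - 2 * R i.
  move=> iN; rewrite /S !coefB coefC coefMn coefGp iN.
  by case: i iN => [|i] _ //=; ring.
clearbody S.
have /dvdXnP /(_ n.+1) := sqrt_deriv_mod dS.
rewrite !derivE /= (_ : _ - _ = (c ^+ 2 * 2)%:P * S^`()
   - 'X * (8%:P * S^`()) + 4%:P * S); last first.
  by rewrite !(rmorphXn, rmorphM, rmorphD) /= !rmorph1; ring.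
rewrite !(coefD, coefB, coefN, coefCM, coefXM, coef_deriv) /=.
have n1N : (n.+1 < N)%N by rewrite /N; lia.
move=> /(_ n1N); rewrite !sS //; try by rewrite /N; lia.
move=> H; apply/eqP; rewrite -subr_eq0; apply/eqP.
rewrite -[RHS](mulr0 (- (4^-1))) -{}H.
by field.
Qed.

End MomentSeries.

(** * Catalan numbers and uniqueness for the recursions *)

Lemma catalan0 (F : numFieldType) : catalan F 0 = 1.
Proof. by rewrite /catalan bin0 divr1 mulr1. Qed.

Lemma catalanS (F : numFieldType) (k : nat) :
  k.+2%:R * catalan F k.+1 = (4 * k.+1%:R - 2) * catalan F k.
Proof.
(* Two absorption identities for binomial coefficients; [4 * k.+1 - 2] is [4k + 2] in the shape of
   the cumulant recursion. *)
have H : (k.+1 * 'C(k.+1.*2, k.+1) = (4 * k.+1 - 2) * 'C(k.*2, k))%N.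
  rewrite -(mul_bin_diag k.+1.*2 k) doubleS /=.
  have := mul_bin_down k.*2.+1 k; rewrite /= (_ : k.*2.+1 - k = k.+1)%N; last by lia.
  by set B := 'C(_, _); set B' := 'C(_, _) => e; nia.
have kn0 j : j.+1%:R != 0 :> F by rewrite pnatr_eq0.
apply: (mulfI (kn0 k)); rewrite /catalan.
transitivity ((k.+1 * 'C(k.+1.*2, k.+1))%:R : F).
  by rewrite natrM; field; rewrite -natrD pnatr_eq0.
rewrite H natrM natrB ?natrM; last by lia.
by field; rewrite -(natrD _ 1) pnatr_eq0.
Qed.

(** The recursion is that of the Catalan numbers, except that each step brings a factor [c^-2]. *)
Lemma cumulant_catalan (F : numFieldType) (R : nat -> F) (c : F) :
  c != 0 -> R 1 = c^-1 ->
  (forall n, (0 < n)%N -> n.+1%:R * c ^+ 2 * R n.+1 = (4 * n%:R - 2) * R n) ->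
  forall n, (1 <= n)%N -> R n = 1 / c ^+ (2 * n - 1) * catalan F (n - 1).
Proof.
move=> c0 R1 RS; case=> // n _; rewrite (_ : 2 * n.+1 - 1 = (2 * n).+1)%N; last by lia.
rewrite subn1 /=.
elim: n => [|n IH]; first by rewrite muln0 R1 catalan0 mulr1 div1r.
have kn0 j : j.+1%:R != 0 :> F by rewrite pnatr_eq0.
apply: (mulfI (mulf_neq0 (kn0 n.+1) (expf_neq0 2 c0))).
rewrite RS // IH mulnS !exprS -[in RHS]mulrA.
rewrite [RHS](_ : _ = (n.+2%:R * catalan F n.+1) / (c * c ^+ (2 * n))).
  by rewrite catalanS; field; rewrite c0 expf_neq0.
by field; rewrite c0 expf_neq0.
Qed.

(** The leading coefficient is invertible. This identifies the moments of [X^-1] with integrals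
    against the two laws. *)
Lemma three_term_rec_unique (F : numFieldType) (c r : F) (u v : nat -> F) :
  c != 0 -> u 0 = v 0 -> u 1 = v 1 ->
  (forall n, (0 < n)%N -> n.+1%:R * c ^+ 2 * u n.+1 =
     (2 * n%:R - 1) * (r + 1) * u n - (n%:R - 2) * u n.-1) ->
  (forall n, (0 < n)%N -> n.+1%:R * c ^+ 2 * v n.+1 =
     (2 * n%:R - 1) * (r + 1) * v n - (n%:R - 2) * v n.-1) ->
  u =1 v.
Proof.
move=> c0 e0 e1 Hu Hv n; suff [] : u n = v n /\ u n.+1 = v n.+1 by [].
elim: n => [//|n [IH1 IH2]]; split=> //.
have nz : n.+2%:R * c ^+ 2 != 0 by rewrite mulf_neq0 ?expf_neq0 // pnatr_eq0.
by apply: (mulfI nz); rewrite Hu // Hv // IH2 /= IH1.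
Qed.

From mathcomp Require Import all_classical all_reals all_analysis.
From mathcomp Require Import measurable_realfun.
From mathcomp.real_closed Require Import complex.

Import numFieldNormedType.Exports.
Local Open Scope complex_scope.

(** * Free Poisson and free gamma integrals *)

Section RealDerivatives.
Variable R : realType.
Implicit Types (f g : R -> R) (x : R).

Lemma is_derive_congr f g x df dg : is_derive x 1 f df -> f =1 g -> df = dg ->
  is_derive x 1 g dg.
Proof. by move=> + /funext <- <-. Qed.

Lemma is_derive_add f g x df dg : is_derive x 1 f df -> is_derive x 1 g dg ->
  is_derive x 1 (fun y => f y + g y) (df + dg).
Proof. by move=> Df Dg; exact: is_deriveD. Qed.

Lemma is_derive_mul f g x df dg : is_derive x 1 f df -> is_derive x 1 g dg ->
  is_derive x 1 (fun y => f y * g y) (df * g x + f x * dg).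
Proof.
move=> Df Dg; apply: (is_derive_congr (is_deriveM Df Dg)) => //.
by rewrite addrC mulrC.
Qed.

Lemma is_derive_inv f x df : is_derive x 1 f df -> f x != 0 ->
  is_derive x 1 (fun y => (f y)^-1) (- df / f x ^+ 2).
Proof.
move=> Df f0; apply: (is_derive_congr (is_deriveV f0 Df)) => //.
by rewrite mulNr mulrC -mulNr.
Qed.

Lemma is_derive_sqrt f x df : is_derive x 1 f df -> 0 < f x ->
  is_derive x 1 (fun y => Num.sqrt (f y)) (df / (2 * Num.sqrt (f x))).
Proof.
move=> Df f0; apply: (is_derive_congr (is_derive1_comp (is_derive1_sqrt f0) Df)) => //.
by rewrite mulrC.
Qed.

Lemma is_derive_atan f x df : is_derive x 1 f df ->
  is_derive x 1 (fun y => atan (f y)) (df / (1 + f x ^+ 2)).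
Proof.
move=> Df; apply: (is_derive_congr (is_derive1_comp (is_derive1_atan _) Df)) => //.
by rewrite mulrC.
Qed.

Lemma is_derive_exprz (k : int) x : x != 0 ->
  is_derive x 1 (fun y : R => y ^ k) (k%:~R * x ^ (k - 1)).
Proof.
move=> x0.
have P (n : nat) : is_derive x 1 (fun y : R => y ^+ n) (n%:R * x ^+ n.-1).
  apply: (is_derive_congr (@is_deriveX _ _ id n x 1 1 _)).
    by move=> y; rewrite exprfctE.
  by rewrite -[LHS]/(_ * 1) mulr1.
case: k => n.
  apply: (is_derive_congr (P n)) => //; case: n => [|n]; first by rewrite !mul0r.
  by rewrite (_ : (n.+1 : int) - 1 = n) //; lia.
apply: (is_derive_congr (is_derive_inv (P n.+1) _)) => //.
  by rewrite expf_neq0.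
rewrite NegzE -opprD -PoszD addn1 -exprnN rmorphN /= !mulNr -mulrA; congr (- (_ * _)).
by rewrite !exprS; field; rewrite x0 expf_neq0.
Qed.

Lemma continuous_exprz (k : int) x : x != 0 ->
  {for x, continuous (fun y : R => y ^ k)}.
Proof.
move=> x0; apply/differentiable_continuous/derivable1_diffP.
by have [] := is_derive_exprz k x0.
Qed.

(* [4 atan (p / (sqrt (p^2 + s^2) + s))] is twice the angle [atan2 p s]; unlike
   [asin] it is continuous up to the end points of the intervals used here. *)
Definition twice_angle (p s : R) : R :=
  4 * atan (p / (Num.sqrt (p ^+ 2 + s ^+ 2) + s)).

Lemma is_derive_twice_angle (p s : R -> R) x dp ds : 0 < p x -> 0 < s x ->
  is_derive x 1 p dp -> is_derive x 1 s ds ->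
  is_derive x 1 (fun y => twice_angle (p y) (s y))
    (2 * (dp * s x - p x * ds) / (p x ^+ 2 + s x ^+ 2)).
Proof.
move=> p0 s0 Dp Ds.
have q2 : 0 < p x ^+ 2 + s x ^+ 2 by rewrite addr_gt0 ?exprn_gt0.
pose q := Num.sqrt (p x ^+ 2 + s x ^+ 2).
have q0 : 0 < q by rewrite sqrtr_gt0.
have qq : q ^+ 2 = p x ^+ 2 + s x ^+ 2 by rewrite sqr_sqrtr // ltW.
have q2' : 0 < p x * p x + s x * s x by rewrite -!expr2.
have Dq := is_derive_sqrt (is_derive_add (is_derive_mul Dp Dp) (is_derive_mul
  Ds Ds)) q2'.
have D := is_derive_mul (is_derive_cst (4 : R) x 1) (is_derive_atan
  (is_derive_mul Dp (is_derive_inv (is_derive_add Dq Ds) _))).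
rewrite /= -!expr2 -/q in D.
apply: (is_derive_congr (D (lt0r_neq0 (addr_gt0 q0 s0)))) => //; rewrite /= -/q.
rewrite mul0r add0r -qq.
have p2 : p x ^+ 2 = q ^+ 2 - s x ^+ 2 by rewrite qq addrK.
(* Half-angle identity, from [p^2 = (q - s) (q + s)]. *)
have e : 1 + (p x / (q + s x)) ^+ 2 = 2 * q / (q + s x).
  by rewrite expr_div_n p2; field; rewrite gt_eqF // addr_gt0.
rewrite e.
suff -> : dp / (q + s x) + p x * (- ((dp * p x + p x * dp + (ds * s x + s x *
  ds)) / (2 * q) + ds) / (q + s x) ^+ 2)
   = (dp * s x - p x * ds) / (q * (q + s x)).
  by field; rewrite !gt_eqF // addr_gt0.
transitivity ((dp * (q + s x) * q - dp * p x ^+ 2 - p x * (ds * s x) - p x * q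
  * ds) / (q * (q + s x) ^+ 2)).
  by field; rewrite !gt_eqF // addr_gt0.
by rewrite p2; field; rewrite !gt_eqF // addr_gt0.
Qed.

Lemma continuous_twice_angle (p s : R -> R) x : 0 <= s x -> 0 < p x ^+ 2 + s x ^+ 2 ->
  {for x, continuous p} -> {for x, continuous s} ->
  {for x, continuous (fun y => twice_angle (p y) (s y))}.
Proof.
move=> s0 q0 cp cs; rewrite /twice_angle.
have cq : {for x, continuous (fun y => Num.sqrt (p y ^+ 2 + s y ^+ 2))}.
  apply: (@continuous_comp _ _ _ (fun y => p y ^+ 2 + s y ^+ 2) (@Num.sqrt R)).
    by apply: cvgD; apply: cvgM.
  exact: sqrt_continuous.
have ct : {for x, continuous (fun y => p y / (Num.sqrt (p y ^+ 2 + s y ^+ 2) + s y))}.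
  apply: cvgM => //; apply: cvgV; last exact: cvgD.
  by rewrite gt_eqF // ltr_wpDr // sqrtr_gt0.
apply: cvgM; first exact: cvg_cst.
exact: (continuous_comp ct (@continuous_atan _ _)).
Qed.

Lemma twice_angle0 s : twice_angle 0 s = 0.
Proof. by rewrite /twice_angle mul0r atan0 mulr0. Qed.

Lemma twice_angle_pi p : 0 < p -> twice_angle p 0 = pi.
Proof.
move=> p0; rewrite /twice_angle expr0n addr0 addr0 sqrtr_sqr gtr0_norm //.
by rewrite divff ?gt_eqF // atan1 mulrCA divff ?mulr1.
Qed.

End RealDerivatives.

(** * Integrals of integer powers against a semicircle *)

Section SemicircleIntegrals.
Local Open Scope classical_set_scope.
Variable R : realType.
Local Notation mu := (@lebesgue_measure R).

Lemma continuous_itv_integrable (f : R -> R) (a b : R) :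
  (forall x, a <= x <= b -> {for x, continuous f}) ->
  mu.-integrable `[a, b] (EFin \o f).
Proof.
move=> cf; apply: continuous_compact_integrable; first exact: segment_compact.
apply: continuous_in_subspaceT => x; rewrite inE /= in_itv /=; exact: cf.
Qed.

Lemma Rintegral_FTC (F f : R -> R) (a b : R) : a < b ->
  (forall x, a <= x <= b -> {for x, continuous f}) ->
  (forall x, a <= x <= b -> {for x, continuous F}) ->
  (forall x, a < x < b -> is_derive x 1 F (f x)) ->
  \int[mu]_(x in `[a, b]) f x = F b - F a.
Proof.
move=> ab cf cF DF; rewrite /Rintegral (@continuous_FTC2 _ f F) //.
- apply: continuous_in_subspaceT => x; rewrite inE /= in_itv /=; exact: cf.
- split.
  + by move=> x; rewrite in_itv /= => /DF[].
  + by apply: cvg_at_right_filter; apply: cF; rewrite lexx ltW.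
  + by apply: cvg_at_left_filter; apply: cF; rewrite lexx ltW.
- move=> x; rewrite in_itv /= => /DF D; rewrite derive1E.
  exact: derive_val.
Qed.

Definition semicircle (a b x : R) : R := Num.sqrt ((x - a) * (b - x)).

(** The exponent is an integer because the two densities bring factors [1 / x] and [1 / x^2]. *)
Definition semicircle_moment (a b : R) (k : int) : R :=
  \int[mu]_(x in `[a, b]) (x ^ k * semicircle a b x).

Variables a b : R.
Hypotheses (a0 : 0 < a) (ab : a < b).
Local Notation w := (semicircle a b).
Local Notation I := (semicircle_moment a b).

Let pos x : a <= x <= b -> 0 < x.
Proof. by move=> /andP[+ _]; exact: lt_le_trans. Qed.

Let b0 : 0 < b. Proof. exact: lt_trans ab. Qed.

Let w2 x : a <= x <= b -> w x ^+ 2 = (x - a) * (b - x).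
Proof. by move=> /andP[ax xb]; rewrite sqr_sqrtr // mulr_ge0 // subr_ge0. Qed.

Let w_gt0 x : a < x < b -> 0 < w x.
Proof. by move=> /andP[ax xb]; rewrite sqrtr_gt0 mulr_gt0 // subr_gt0. Qed.

Let continuous_subl (x c : R) : {for x, continuous (fun y : R => y - c)}.
Proof. by apply: cvgB; [exact: cvg_id|exact: cvg_cst]. Qed.

Let continuous_subr (x c : R) : {for x, continuous (fun y : R => c - y)}.
Proof. by apply: cvgB; [exact: cvg_cst|exact: cvg_id]. Qed.

Lemma continuous_semicircle (x : R) : {for x, continuous w}.
Proof.
apply: (@continuous_comp _ _ _ (fun y => (y - a) * (b - y)) (@Num.sqrt R)).
  by apply: cvgM; [exact: continuous_subl|exact: continuous_subr].
exact: sqrt_continuous.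
Qed.

Lemma continuous_exprz_semicircle (k : int) (x : R) : a <= x <= b ->
  {for x, continuous (fun y : R => y ^ k * w y)}.
Proof.
move=> xab; apply: cvgM; last exact: continuous_semicircle.
by apply: continuous_exprz; rewrite gt_eqF // pos.
Qed.

Lemma integrable_exprz_semicircle (k : int) :
  mu.-integrable `[a, b] (EFin \o (fun x : R => x ^ k * w x)).
Proof. by apply: continuous_itv_integrable => x;
  exact: continuous_exprz_semicircle. Qed.

Let Dsubl (x c : R) : is_derive x 1 (fun y : R => y - c) 1.
Proof.
apply: (is_derive_congr (is_derive_add (is_derive_id x (1 : R)) (is_derive_cst
  (- c) x 1))) => //.
by rewrite addr0.
Qed.

Let Dsubr (x c : R) : is_derive x 1 (fun y : R => c - y) (- 1).
Proof.
have D := is_derive_add (is_derive_cst c x 1) (is_deriveN (is_derive_id x (1 : R))).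
by apply: (is_derive_congr D) => //; rewrite add0r.
Qed.

Lemma is_derive_semicircle x : a < x < b ->
  is_derive x 1 w ((a + b - 2 * x) / (2 * w x)).
Proof.
move=> xab; have /andP[ax xb] := xab.
have D := is_derive_sqrt (is_derive_mul (Dsubl x a) (Dsubr x b)) _.
apply: (is_derive_congr (D _)) => //; first by rewrite mulr_gt0 // subr_gt0.
by congr (_ / _); ring.
Qed.

(** The function [x^k w^3] vanishes at both end points. As [w^2] is a quadratic polynomial, its
    derivative is [w] times a combination of [x^(k+1)], [x^k] and [x^(k-1)]. *)
Lemma semicircle_moment_rec (k : int) :
  (k%:~R + 3) * I (k + 1) - (k%:~R + 3 / 2) * (a + b) * I k
    + k%:~R * (a * b) * I (k - 1) = 0.
Proof.
pose f (x : R) := (k%:~R + 3) * (x ^ (k + 1) * w x)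
  - (k%:~R + 3 / 2) * (a + b) * (x ^ k * w x) + k%:~R * (a * b) * (x ^ (k - 1) * w x).
have int := integrable_exprz_semicircle.
have intZ c j : mu.-integrable `[a, b] (EFin \o (fun x : R => c * (x ^ j * w x))).
  exact: (@integrableZl _ _ _ mu `[a, b] _ c (EFin \o (fun x : R => x ^ j * w x))).
transitivity (\int[mu]_(x in `[a, b]) f x).
  rewrite /f RintegralD // ?RintegralB ?RintegralZl //.
  exact: (@integrableB _ _ _ mu `[a, b] _ (EFin \o (fun x : R => _ * (x ^ _ * w
    x))) (EFin \o (fun x : R => _ * (x ^ _ * w x)))).
pose F (x : R) := - 1 * (x ^ k * (w x * (w x * w x))).
have wa : w a = 0 by rewrite /semicircle subrr mul0r sqrtr0.
have wb : w b = 0 by rewrite /semicircle subrr mulr0 sqrtr0.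
transitivity (F b - F a); last by rewrite /F wa wb !mul0r !mulr0 subrr.
apply: Rintegral_FTC => //.
- move=> x xab; have c j := @continuous_exprz_semicircle j x xab.
  have cZ d j : {for x, continuous (fun y : R => d * (y ^ j * w y))}.
    by apply: cvgM; [exact: cvg_cst|exact: c].
  by apply: cvgD; [apply: cvgB|]; exact: cZ.
- move=> x xab; have c := @continuous_semicircle x.
  apply: cvgM; first exact: cvg_cst.
  apply: cvgM; first by apply: continuous_exprz; rewrite gt_eqF // pos.
  by apply: cvgM => //; apply: cvgM.
- move=> x xab; have /andP[ax xb] := xab.
  have x0 : x != 0 by rewrite gt_eqF // pos // !ltW.
  have wx := w_gt0 xab.
  have Dw := is_derive_semicircle xab.
  have D := is_derive_mul (is_derive_cst (-1 : R) x 1) (is_derive_mul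
    (is_derive_exprz k x0)
     (is_derive_mul Dw (is_derive_mul Dw Dw))).
  apply: (is_derive_congr D) => //; rewrite /cst /=.
  have e2 : w x ^+ 2 = (x - a) * (b - x) by rewrite w2 // !ltW.
  rewrite /f !exprzDr ?unitfE // expr1z exprN1.
  set X := x ^ k; set K := k%:~R.
  transitivity (- w x * X / x * (K * w x ^+ 2 + 3 / 2 * x * (a + b - 2 * x))).
    by field; rewrite x0 gt_eqF.
  by rewrite e2; field.
Qed.

(** Antiderivatives of [1 / w] and of [sqrt (a b) / (x w)], both running from 0 to pi on
    [[a, b]]. *)
Let angle1 (x : R) := twice_angle (Num.sqrt (x - a)) (Num.sqrt (b - x)).
Let angle2 (x : R) := twice_angle (Num.sqrt (b * (x - a))) (Num.sqrt (a * (b - x))).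

Let sqrtab : Num.sqrt (a * b) ^+ 2 = a * b.
Proof. by rewrite sqr_sqrtr // mulr_ge0 // ltW. Qed.

Let angle1_cont (x : R) : a <= x <= b -> {for x, continuous angle1}.
Proof.
move=> /andP[ax xb]; apply: continuous_twice_angle; first exact: sqrtr_ge0.
- by rewrite !sqr_sqrtr ?subr_ge0 // addrC addrA subrK subr_gt0.
- exact: (continuous_comp (@continuous_subl x a) (@sqrt_continuous _ _)).
- exact: (continuous_comp (@continuous_subr x b) (@sqrt_continuous _ _)).
Qed.

Let angle2_cont (x : R) : a <= x <= b -> {for x, continuous angle2}.
Proof.
move=> xab; have /andP[ax xb] := xab; have x0 := pos xab.
apply: continuous_twice_angle; first exact: sqrtr_ge0.
- rewrite !sqr_sqrtr ?mulr_ge0 ?subr_ge0 // 1?ltW //.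
  rewrite (_ : _ + _ = x * (b - a)); last by ring.
  by rewrite mulr_gt0 // subr_gt0.
- apply: (@continuous_comp _ _ _ (fun y : R => b * (y - a)) (@Num.sqrt R)).
    by apply: cvgM; [exact: cvg_cst|exact: continuous_subl].
  exact: sqrt_continuous.
- apply: (@continuous_comp _ _ _ (fun y : R => a * (b - y)) (@Num.sqrt R)).
    by apply: cvgM; [exact: cvg_cst|exact: continuous_subr].
  exact: sqrt_continuous.
Qed.

Let angle1_a : angle1 a = 0.
Proof. by rewrite /angle1 subrr sqrtr0 twice_angle0. Qed.

Let angle1_b : angle1 b = pi.
Proof. by rewrite /angle1 subrr sqrtr0 twice_angle_pi // sqrtr_gt0 subr_gt0. Qed.

Let angle2_a : angle2 a = 0.
Proof. by rewrite /angle2 subrr mulr0 sqrtr0 twice_angle0. Qed.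

Let angle2_b : angle2 b = pi.
Proof.
by rewrite /angle2 subrr mulr0 sqrtr0 twice_angle_pi // sqrtr_gt0 mulr_gt0 // subr_gt0.
Qed.

Let Dangle1 (x : R) : a < x < b -> is_derive x 1 angle1 (w x)^-1.
Proof.
move=> xab; have /andP[ax xb] := xab.
have p0 : 0 < x - a by rewrite subr_gt0.
have s0 : 0 < b - x by rewrite subr_gt0.
have := p0; have := s0; rewrite -sqrtr_gt0 => s0'; rewrite -sqrtr_gt0 => p0'.
have D := is_derive_twice_angle _ _ (is_derive_sqrt (Dsubl x a) p0)
  (is_derive_sqrt (Dsubr x b) s0).
apply: (is_derive_congr (D p0' s0')) => //; rewrite /cst /=.
have ep := sqr_sqrtr (ltW p0); have es := sqr_sqrtr (ltW s0).
rewrite /semicircle sqrtrM ?ltW //.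
set p := Num.sqrt (x - a) in p0' ep *; set s := Num.sqrt (b - x) in s0' es *.
have q0 : p ^+ 2 + s ^+ 2 != 0 by rewrite gt_eqF // addr_gt0 // exprn_gt0.
by field; rewrite q0 !gt_eqF.
Qed.

Let Dangle2 (x : R) : a < x < b ->
  is_derive x 1 angle2 (Num.sqrt (a * b) / (x * w x)).
Proof.
move=> xab; have /andP[ax xb] := xab.
have x0 : 0 < x by rewrite pos // !ltW.
have p0 : 0 < x - a by rewrite subr_gt0.
have s0 : 0 < b - x by rewrite subr_gt0.
have bp0 : 0 < b * (x - a) by rewrite mulr_gt0.
have as0 : 0 < a * (b - x) by rewrite mulr_gt0.
have := bp0; have := as0; rewrite -sqrtr_gt0 => s0'; rewrite -sqrtr_gt0 => p0'.
have D := is_derive_twice_angle _ _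
  (is_derive_sqrt (is_derive_mul (is_derive_cst b x 1) (Dsubl x a)) bp0)
  (is_derive_sqrt (is_derive_mul (is_derive_cst a x 1) (Dsubr x b)) as0).
apply: (is_derive_congr (D p0' s0')) => //; rewrite /cst /=.
rewrite !sqr_sqrtr ?ltW //.
rewrite (_ : b * (x - a) + a * (b - x) = x * (b - a)); last by ring.
have ba0 : b - a != 0 by rewrite subr_eq0 gt_eqF.
rewrite /semicircle !sqrtrM ?ltW //.
have := p0; have := s0; rewrite -sqrtr_gt0 => s0''; rewrite -sqrtr_gt0 => p0''.
have ea := sqr_sqrtr (ltW a0); have eb := sqr_sqrtr (ltW b0).
have a0' := a0; have b0' := b0; rewrite -sqrtr_gt0 in a0'; rewrite -sqrtr_gt0 in b0'.
have ep := sqr_sqrtr (ltW p0); have es := sqr_sqrtr (ltW s0).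
set p := Num.sqrt (x - a) in p0'' ep *; set s := Num.sqrt (b - x) in s0'' es *.
set A := Num.sqrt a in a0' ea *; set B := Num.sqrt b in b0' eb *.
rewrite -ea -eb in ba0; rewrite -[in LHS]ea -[in LHS]eb.
transitivity (A * B * (s ^+ 2 + p ^+ 2) / (p * s * x * (B ^+ 2 - A ^+ 2))).
  by field; rewrite ba0 !gt_eqF.
rewrite es ep (_ : b - x + (x - a) = B ^+ 2 - A ^+ 2); last by rewrite ea eb; ring.
by field; rewrite ba0 !gt_eqF.
Qed.

(** Write [w / x] as [w^2 / (x w) = (a + b - x) / w - a b / (x w)]. The derivative of [w] supplies
    [(a + b) / (2 w) - x / w], and the two angles supply the remaining terms. *)
Lemma semicircle_momentN1 : I (-1) = pi * ((a + b) / 2 - Num.sqrt (a * b)).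
Proof.
pose F (x : R) := w x + ((a + b) / 2 * angle1 x + - Num.sqrt (a * b) * angle2 x).
have wa : w a = 0 by rewrite /semicircle subrr mul0r sqrtr0.
have wb : w b = 0 by rewrite /semicircle subrr mulr0 sqrtr0.
transitivity (F b - F a); last first.
  by rewrite /F wa wb angle1_a angle1_b angle2_a angle2_b; ring.
apply: Rintegral_FTC => //.
- by move=> x; exact: continuous_exprz_semicircle.
- move=> x xab; apply: cvgD; first exact: continuous_semicircle.
  apply: cvgD; apply: cvgM;
    [exact: cvg_cst|exact: angle1_cont|exact: cvg_cst|exact: angle2_cont].
- move=> x xab; have /andP[ax xb] := xab.
  have x0 : x != 0 by rewrite gt_eqF // pos // !ltW.
  have wx := w_gt0 xab.
  have D := is_derive_add (is_derive_semicircle xab) (is_derive_add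
    (is_derive_mul (is_derive_cst ((a + b) / 2) x 1) (Dangle1 xab))
    (is_derive_mul (is_derive_cst (- Num.sqrt (a * b)) x 1) (Dangle2 xab))).
  apply: (is_derive_congr D) => //; rewrite /cst /=.
  have e2 : w x ^+ 2 = (x - a) * (b - x) by rewrite w2 // !ltW.
  rewrite exprN1.
  transitivity ((x * (a + b - x) - Num.sqrt (a * b) ^+ 2) / (x * w x)).
    by field; rewrite x0 gt_eqF.
  rewrite sqrtab (_ : _ - a * b = w x ^+ 2); last by rewrite e2; ring.
  by field; rewrite x0 gt_eqF.
Qed.

(** Integration by parts: [- w / x] leaves the integral of [w' / x = (a + b) / (2 x w) - 1 / w], a
    combination of the two angles. *)
Lemma semicircle_momentN2 :
  I (-2) = pi * ((a + b) / (2 * Num.sqrt (a * b)) - 1).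
Proof.
have s0 : Num.sqrt (a * b) != 0 by rewrite gt_eqF // sqrtr_gt0 mulr_gt0.
pose F (x : R) := (-1) * (w x * x^-1) + ((-1) * angle1 x + (a + b) / (2 *
  Num.sqrt (a * b)) * angle2 x).
have wa : w a = 0 by rewrite /semicircle subrr mul0r sqrtr0.
have wb : w b = 0 by rewrite /semicircle subrr mulr0 sqrtr0.
transitivity (F b - F a); last first.
  by rewrite /F wa wb angle1_a angle1_b angle2_a angle2_b; field; rewrite s0 !gt_eqF.
apply: Rintegral_FTC => //.
- by move=> x; exact: continuous_exprz_semicircle.
- move=> x xab; apply: cvgD.
    apply: cvgM; first exact: cvg_cst.
    apply: cvgM; first exact: continuous_semicircle.
    by apply: inv_continuous; rewrite gt_eqF // pos.
  apply: cvgD; apply: cvgM;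
    [exact: cvg_cst|exact: angle1_cont|exact: cvg_cst|exact: angle2_cont].
- move=> x xab; have /andP[ax xb] := xab.
  have x0 : x != 0 by rewrite gt_eqF // pos // !ltW.
  have wx := w_gt0 xab.
  have D := is_derive_add (is_derive_mul (is_derive_cst (-1 : R) x 1)
      (is_derive_mul (is_derive_semicircle xab) (is_derive_inv (is_derive_id x
        (1 : R)) x0)))
    (is_derive_add
    (is_derive_mul (is_derive_cst (-1 : R) x 1) (Dangle1 xab))
    (is_derive_mul (is_derive_cst ((a + b) / (2 * Num.sqrt (a * b))) x 1)
      (Dangle2 xab))).
  apply: (is_derive_congr D) => //; rewrite /cst /=.
  rewrite (_ : x ^ (-2) = x^-1 ^+ 2); last by rewrite exprVn -exprnN.
  by field; rewrite x0 s0 gt_eqF.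
Qed.

End SemicircleIntegrals.

(** * Probability measures given by a density *)

(** The hypotheses on [h] are arguments so that the measure and probability instances can be
    attached to this constant. *)
Definition density_prob (R : realType) (h : R -> R)
    (mh : measurable_fun [set: R] h) (h0 : forall x, 0 <= h x)
    (h1 : (\int[lebesgue_measure]_x (h x)%:E = 1)%E) :
    set (measurableTypeR R) -> \bar R :=
  fun B => (\int[lebesgue_measure]_(x in B) (h x)%:E)%E.

Section DensityProb.
Local Open Scope classical_set_scope.
Variables (R : realType) (h : R -> R).
Hypotheses (mh : measurable_fun [set: R] h) (h0 : forall x, 0 <= h x).
Hypothesis h1 : (\int[lebesgue_measure]_x (h x)%:E = 1)%E.
Local Notation mu := (@lebesgue_measure R).
Local Notation P := (density_prob mh h0 h1).

Let density_prob0 : P set0 = 0%E.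
Proof. by rewrite /density_prob integral_set0. Qed.

Let density_prob_ge0 B : (0 <= P B)%E.
Proof. by apply: integral_ge0 => x _; rewrite lee_fin. Qed.

Let density_prob_sigma_additive : semi_sigma_additive P.
Proof.
move=> /= F mF tF mUF; rewrite /density_prob; apply: cvg_toP.
  apply: ereal_nondecreasing_is_cvgn => m n mn.
  by apply: lee_sum_nneg_natr => // k _ _; apply: integral_ge0 => /= x _;
    rewrite lee_fin.
rewrite ge0_integral_bigcup//=.
- by apply/measurable_funTS/measurableT_comp.
- by move=> x _; rewrite lee_fin.
Qed.

HB.instance Definition _ := isMeasure.Build _ _ _ P
  density_prob0 density_prob_ge0 density_prob_sigma_additive.

HB.instance Definition _ := @Measure_isProbability.Build _ _ R P h1.

Lemma density_prob_dominates : P `<< mu.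
Proof.
apply/null_content_dominatesP => A mA muA0; apply: null_set_integral => //.
by apply: measurable_funTS; exact: measurableT_comp.
Qed.

(** Integrals against [P] are computed through its Radon-Nikodym derivative, which equals [h] almost
    everywhere. *)
Let RN := Radon_Nikodym_SigmaFinite.f P mu.

Let RN_density : ae_eq mu setT RN (EFin \o h).
Proof.
apply: integral_ae_eq => //.
- exact: Radon_Nikodym_SigmaFinite.f_integrable density_prob_dominates.
- exact: measurableT_comp.
- by move=> E _ mE; rewrite -Radon_Nikodym_SigmaFinite.f_integral //;
  exact: density_prob_dominates.
Qed.

Lemma density_prob_integrable (g : R -> R) : measurable_fun [set: R] g ->
  mu.-integrable [set: R] (fun x => (g x * h x)%:E) ->
  P.-integrable [set: measurableTypeR R] (fun x => (g x)%:E).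
Proof.
move=> mg /integrableP[_ ig]; apply/integrableP; split; first exact: measurableT_comp.
have mG : measurable_fun [set: R] (fun x => `|(g x)%:E|%E).
  by do 2 apply: measurableT_comp => //.
rewrite -(Radon_Nikodym_SigmaFinite.change_of_variables density_prob_dominates) //.
suff <- : (\int[mu]_x (`|(g x)%:E| * (h x)%:E) =
    \int[mu]_x (`|(g x)%:E| * RN x))%E.
  move: ig; congr (_ < _)%E; apply: eq_integral => x _ /=.
  by rewrite normrM EFinM (ger0_norm (h0 x)).
apply: ae_eq_integral => //.
- by apply: emeasurable_funM => //; exact: measurableT_comp.
- apply: emeasurable_funM => //.
  exact: measurable_int (Radon_Nikodym_SigmaFinite.f_integrable density_prob_dominates).
- by apply: ae_eqe_mul2l; exact: ae_eq_sym RN_density.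
Qed.

Lemma density_prob_integral (g : R -> R) : measurable_fun [set: R] g ->
  mu.-integrable [set: R] (fun x => (g x * h x)%:E) ->
  (\int[P]_x (g x)%:E = \int[mu]_x (g x * h x)%:E)%E.
Proof.
move=> mg ig; have igP := density_prob_integrable mg ig.
rewrite -(Radon_Nikodym_change_of_variables density_prob_dominates) //.
have mRN : measurable_fun [set: R] (Radon_Nikodym (charge_of_finite_measure P) mu).
  apply: (measurable_int mu); apply: Radon_Nikodym_integrable.
  exact: density_prob_dominates.
under [RHS]eq_integral do rewrite EFinM.
apply: ae_eq_integral => //.
- by apply: emeasurable_funM => //; exact: measurableT_comp.
- by apply: emeasurable_funM => //; exact: measurableT_comp.
- apply: ae_eqe_mul2l; apply: ae_eq_trans RN_density.
  apply: ae_eq_sym; apply: ae_eq_Radon_Nikodym_SigmaFinite => //.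
  exact: density_prob_dominates.
Qed.

End DensityProb.

(** The open interval matches the supports of the laws, and the closed one suits the fundamental
    theorem of calculus; the end points form a null set. *)
Lemma exists_density_law (R : realType) (a b : R) (f : R -> R) :
  (forall x, (a <= x <= b)%R -> {for x, continuous f}) ->
  (forall x, (a <= x <= b)%R -> 0 <= f x) ->
  \int[lebesgue_measure]_(x in `[a, b]%classic) f x = 1 ->
  exists nu : probability (measurableTypeR R) R,
    (forall B, measurable B ->
       (nu B = \int[lebesgue_measure]_(x in (B `&` `]a, b[)%classic) (f x)%:E)%E) /\
    (forall g : R -> R, continuous g ->
       nu.-integrable [set: measurableTypeR R] (fun x => (g x)%:E) /\
       \int[nu]_x g x = \int[lebesgue_measure]_(x in `[a, b]%classic) (g x * f x)).
Proof.
move=> cf f0 f1; pose I := `]a, b[%classic; pose h := f \_ I.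
have subI (x : R) : I x -> a <= x <= b.
  by rewrite /I /= in_itv /= => /andP[ax xb]; rewrite !ltW.
have mI : measurable I by exact: measurable_itv.
have intf (g : R -> R) : (forall x, a <= x <= b -> {for x, continuous g}) ->
    lebesgue_measure.-integrable I (EFin \o g).
  move=> cg; apply: integrableS (continuous_itv_integrable cg) => //.
have h0 x : 0 <= h x.
  by rewrite /h patchE; case: ifP => // /set_mem /subI /f0.
have mh : measurable_fun [set: R] h.
  apply/(measurable_restrictT _ mI).
  by apply/measurable_EFinP; exact: measurable_int (intf f cf).
have intoo (g : R -> R) : (forall x, a <= x <= b -> {for x, continuous g}) ->
    (\int[lebesgue_measure]_(x in I) (g x)%:E =
     \int[lebesgue_measure]_(x in `[a, b]%classic) (g x)%:E)%E.
  move=> cg; apply/esym/integral_itv_bndoo.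
  exact: measurable_int (intf g cg).
have int1 (g : R -> R) : (forall x, a <= x <= b -> {for x, continuous g}) ->
    (\int[lebesgue_measure]_(x in `[a, b]%classic) (g x)%:E)%E =
    (\int[lebesgue_measure]_(x in `[a, b]%classic) g x)%:E.
  move=> cg; rewrite /Rintegral fineK //; apply: integrable_fin_num => //.
  exact: continuous_itv_integrable.
have mulh (g : R -> R) : (fun x => (g x * h x)%:E) = (EFin \o (fun x => g x * f
  x)) \_ I.
  by apply/funext => x; rewrite /h !patchE; case: ifP; rewrite ?mulr0.
have h1 : (\int[lebesgue_measure]_x (h x)%:E = 1)%E.
  transitivity (\int[lebesgue_measure]_(x in I) (f x)%:E)%E.
    rewrite [RHS]integral_mkcond; apply: eq_integral => x _.
    by rewrite /h !patchE; case: ifP.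
  by rewrite intoo // int1 // f1.
exists (density_prob mh h0 h1); split=> [B mB|g cg].
  rewrite /= /density_prob integral_mkcondr; apply: eq_integral => x _.
  by rewrite /h !patchE; case: ifP.
have mg : measurable_fun [set: R] g by exact: continuous_measurable_fun.
have cgf x : a <= x <= b -> {for x, continuous (fun x => g x * f x)}.
  by move=> xab; apply: cvgM; [exact: cg|exact: cf].
have ig : lebesgue_measure.-integrable [set: R] (fun x => (g x * h x)%:E).
  by rewrite mulh; apply/integrable_restrict => //; rewrite setTI; exact: intf.
split; first exact: density_prob_integrable.
by rewrite /Rintegral density_prob_integral // mulh -integral_mkcond intoo.
Qed.

(** * Geometric decay of weighted moments *)

Section WeightedMoments.
Local Open Scope classical_set_scope.
Variables (R : realType) (a b : R).
Hypotheses (a0 : 0 < a) (ab : a < b).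
Local Notation mu := (@lebesgue_measure R).
Local Notation w := (semicircle a b).
Local Notation I := (semicircle_moment a b).

(** The factor [1 - a / x] is the function that corresponds to [U = 1 - a Y]. *)
Definition weighted_moment (K : nat) (k : int) : R :=
  \int[mu]_(x in `[a, b]) (x ^ k * (1 - a / x) ^+ K * w x).

Let pos x : a <= x <= b -> 0 < x.
Proof. by move=> /andP[+ _]; exact: lt_le_trans. Qed.

Let integrable_weighted K (k : int) :
  mu.-integrable `[a, b] (EFin \o (fun x : R => x ^ k * (1 - a / x) ^+ K * w x)).
Proof.
apply: continuous_itv_integrable => x xab; have x0 : x != 0 by rewrite gt_eqF ?pos.
apply: cvgM; last exact: continuous_semicircle.
apply: cvgM; first exact: continuous_exprz.
apply: (@continuous_comp _ _ _ (fun y : R => 1 - a / y) (fun y => y ^+ K)).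
  apply: cvgB; first exact: cvg_cst.
  by apply: cvgM; [exact: cvg_cst|exact: inv_continuous].
exact: exprn_continuous.
Qed.

Lemma weighted_moment0 k : weighted_moment 0 k = I k.
Proof. by apply: eq_Rintegral => x _; rewrite expr0 mulr1. Qed.

Lemma weighted_momentS K k :
  weighted_moment K.+1 k = weighted_moment K k - a * weighted_moment K (k - 1).
Proof.
rewrite -RintegralZl // -RintegralB //; last first.
  exact: (@integrableZl _ _ _ mu `[a, b] _ a (EFin \o _)).
apply: eq_Rintegral => x; rewrite inE /= in_itv /= => xab.
have x0 : x != 0 by rewrite gt_eqF ?pos.
by rewrite exprzDr ?unitfE // exprN1 exprS; field.
Qed.

(** As [a] is the left end point, [1 - a / x] is nonnegative on [[a, b]], and it increases up to
    [1 - a / b < 1]. *)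
Lemma weighted_moment_bound K k : 0 <= weighted_moment K k <= (1 - a / b) ^+ K * I k.
Proof.
have fac x : a <= x <= b -> 0 <= 1 - a / x <= 1 - a / b.
  move=> xab; have x0 := pos xab; move: xab => /andP[ax xb].
  have b0 : 0 < b by exact: lt_trans ab.
  rewrite subr_ge0 ler_pdivrMr // mul1r ax /= lerD2l lerN2.
  by rewrite ler_pM2l // lef_pV2 ?posrE.
apply/andP; split.
  apply: Rintegral_ge0 => x; rewrite /= in_itv /= => xab.
  apply: mulr_ge0 (sqrtr_ge0 _); apply: mulr_ge0.
    by rewrite exprz_ge0 // ltW // pos.
  by rewrite exprn_ge0 //; case/andP: (fac _ xab).
rewrite -RintegralZl //; last exact: integrable_exprz_semicircle.
apply: le_Rintegral => //.
  apply: (@integrableZl _ _ _ mu `[a, b] _ ((1 - a / b) ^+ K) (EFin \o _)) => //.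
  exact: integrable_exprz_semicircle.
move=> x; rewrite /= in_itv /= => xab; have /andP[f0 f1] := fac _ xab.
rewrite mulrCA mulrA ler_wpM2r ?sqrtr_ge0 //.
have xk : 0 <= x ^ k by rewrite exprz_ge0 // ltW // pos.
rewrite ler_wpM2l //.
by rewrite lerXn2r // nnegrE // (le_trans f0).
Qed.

End WeightedMoments.

Lemma geometric_squeeze0 (R : realType) (d rho C : R) : 0 <= rho < 1 ->
  (forall K : nat, `|d| <= rho ^+ K * C) -> d = 0.
Proof.
move=> /andP[r0 r1] H; apply/eqP; rewrite -normr_eq0; apply/eqP/le_anti.
rewrite normr_ge0 andbT.
have cv : ((fun K : nat => rho ^+ K * C) @ \oo --> (0 : R))%classic.
  rewrite -(mul0r C); apply: cvgM; last exact: cvg_cst.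
  by apply: cvg_expr; rewrite ger0_norm.
by apply: (cvgr_to_ge cv); near=> K; exact: H.
Unshelve. all: by end_near. Qed.

(** * Moments of the free Poisson and free gamma laws *)

Section MarchenkoPastur.
Local Open Scope classical_set_scope.
Variables (R : realType) (c : R).
Hypothesis c0 : 0 < c.
(** The parameters of both laws are [lambda = r] and [alpha = 1]. The free Poisson support has ends
    [a] and [b], the free gamma support [b^-1] and [a^-1]. *)
Let r := c + 1.
Let a := (Num.sqrt r - 1) ^+ 2.
Let b := (Num.sqrt r + 1) ^+ 2.

Let r0 : 0 < r. Proof. by rewrite addr_gt0. Qed.

Let sr : Num.sqrt r ^+ 2 = r. Proof. by rewrite sqr_sqrtr // ltW. Qed.

Let sr1 : 1 < Num.sqrt r.
Proof. by rewrite -sqrtr1 ltr_sqrt // ltrDr. Qed.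

Lemma mp_left_gt0 : 0 < a. Proof. by rewrite exprn_gt0 // subr_gt0. Qed.

Lemma mp_left_lt_right : a < b.
Proof. by rewrite /a /b !expr2; have := sr1; nra. Qed.

Lemma mp_endsM : a * b = c ^+ 2.
Proof. by rewrite /a /b -exprMn -subr_sqr_1 sr /r addrK. Qed.

Lemma mp_endsD : a + b = 2 * (r + 1).
Proof.
by rewrite -[in RHS]sr /a /b; ring.
Qed.

Lemma mp_sqrt_ends : Num.sqrt (a * b) = c.
Proof. by rewrite mp_endsM sqrtr_sqr gtr0_norm. Qed.

Let b0 : 0 < b. Proof. exact: lt_trans mp_left_gt0 mp_left_lt_right. Qed.
Let b'0 : 0 < b^-1. Proof. by rewrite invr_gt0. Qed.
Let b'a' : b^-1 < a^-1. Proof. by rewrite ltf_pV2 ?mp_left_lt_right // posrE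
  ?mp_left_gt0. Qed.

(* Moments, of negative order too, of the free Poisson law with parameters
   [lambda = c + 1] and [alpha = 1], supported on [a, b]. *)
Definition mp_moment (k : int) : R := (2 * pi)^-1 * semicircle_moment a b (k - 1).

(* Moments of the free gamma law with the same parameters. *)
Definition fg_moment (n : nat) : R :=
  c / (2 * pi) * semicircle_moment b^-1 a^-1 (n%:Z - 2).

Let pi0 : pi != 0 :> R. Proof. by rewrite gt_eqF // pi_gt0. Qed.

Lemma mp_moment0 : mp_moment 0 = 1.
Proof.
rewrite /mp_moment sub0r semicircle_momentN1 ?mp_left_gt0 ?mp_left_lt_right //.
by rewrite mp_sqrt_ends mp_endsD /r; move: (pi : R) pi0 => p p0; field; rewrite p0.
Qed.

Lemma mp_momentN1 : mp_moment (-1) = c^-1.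
Proof.
rewrite /mp_moment (_ : -1 - 1 = -2 :> int) // semicircle_momentN2 ?mp_left_gt0
  ?mp_left_lt_right //.
by rewrite mp_sqrt_ends mp_endsD /r; move: (pi : R) pi0 => p p0; field;
  rewrite p0 gt_eqF.
Qed.

(** The case [k = - (n + 1)] of [semicircle_moment_rec], with [a b = c^2] and
    [a + b = 2 (r + 1)]. *)
Lemma mp_moment_rec n : (0 < n)%N ->
  n.+1%:R * c ^+ 2 * mp_moment (- n.+1%:Z) =
  (2 * n%:R - 1) * (r + 1) * mp_moment (- n%:Z) - (n%:R - 2) * mp_moment (- n.-1%:Z).
Proof.
case: n => // n _.
have H := semicircle_moment_rec mp_left_gt0 mp_left_lt_right (- n.+2%:Z).
rewrite mp_endsM mp_endsD in H.
rewrite /mp_moment /= (_ : - n%:Z - 1 = - n.+2%:Z + 1); last by lia.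
rewrite (_ : - n.+1%:Z - 1 = - n.+2%:Z); last by lia.
apply/eqP; rewrite -subr_eq0 -[0](mulr0 (- (2 * pi)^-1)) -H; apply/eqP.
by rewrite rmorphN /=; move: (pi : R) pi0 => p p0; field.
Qed.

(** The case [k = n - 2] of [semicircle_moment_rec] on the inverted interval, whose ends have
    product [c^-2] and sum [2 (r + 1) / c^2]. *)
Lemma fg_moment_rec n : (0 < n)%N ->
  n.+1%:R * c ^+ 2 * fg_moment n.+1 =
  (2 * n%:R - 1) * (r + 1) * fg_moment n - (n%:R - 2) * fg_moment n.-1.
Proof.
case: n => // n _.
have H := semicircle_moment_rec b'0 b'a' (n.+1%:Z - 2).
rewrite /fg_moment /= (_ : n.+2%:Z - 2 = n.+1%:Z - 2 + 1); last by lia.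
rewrite (_ : n%:Z - 2 = n.+1%:Z - 2 - 1); last by lia.
have a0 : a != 0 by rewrite gt_eqF ?mp_left_gt0.
have b0' : b != 0 by rewrite gt_eqF.
have c0' : c != 0 by rewrite gt_eqF.
have eD : b^-1 + a^-1 = 2 * (r + 1) / c ^+ 2.
  by rewrite -mp_endsM -mp_endsD; field; rewrite a0 b0'.
have eM : b^-1 * a^-1 = (c ^+ 2)^-1 by rewrite -mp_endsM [RHS]invfM mulrC.
rewrite eD eM in H.
apply/eqP; rewrite -subr_eq0 -[0](mulr0 (c ^+ 2 * (c / (2 * pi)))) -H; apply/eqP.
by rewrite rmorphB /=; move: (pi : R) pi0 => p p0; field; rewrite p0 c0'.
Qed.

Lemma fg_moment0 : fg_moment 0 = 1.
Proof.
rewrite /fg_moment sub0r semicircle_momentN2 //.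
have a0 : a != 0 by rewrite gt_eqF ?mp_left_gt0.
have b0' : b != 0 by rewrite gt_eqF.
have c0' : c != 0 by rewrite gt_eqF.
have eD : b^-1 + a^-1 = 2 * (r + 1) / c ^+ 2.
  by rewrite -mp_endsM -mp_endsD; field; rewrite a0 b0'.
have eM : Num.sqrt (b^-1 * a^-1) = c^-1.
  by rewrite mulrC -[a^-1 * b^-1]invfM mp_endsM sqrtrV ?exprn_ge0 ?ltW //
    sqrtr_sqr gtr0_norm.
by rewrite eD eM /r; move: (pi : R) pi0 => p p0; field; rewrite p0 c0'.
Qed.

Lemma fg_moment1 : fg_moment 1 = c^-1.
Proof.
rewrite /fg_moment (_ : 1%:Z - 2 = -1) // semicircle_momentN1 //.
have a0 : a != 0 by rewrite gt_eqF ?mp_left_gt0.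
have b0' : b != 0 by rewrite gt_eqF.
have c0' : c != 0 by rewrite gt_eqF.
have eD : b^-1 + a^-1 = 2 * (r + 1) / c ^+ 2.
  by rewrite -mp_endsM -mp_endsD; field; rewrite a0 b0'.
have eM : Num.sqrt (b^-1 * a^-1) = c^-1.
  by rewrite mulrC -[a^-1 * b^-1]invfM mp_endsM sqrtrV ?exprn_ge0 ?ltW //
    sqrtr_sqr gtr0_norm.
by rewrite eD eM /r; move: (pi : R) pi0 => p p0; field; rewrite p0 c0'.
Qed.

End MarchenkoPastur.

(** * States *)

Section SelfAdjoint.
Variables (R : realType) (A : cStarAlgType R).
Implicit Types x y : A.

Lemma star1 : star (1 : A) = 1.
Proof. by rewrite -[RHS]starK -[star 1 in RHS]mulr1 starM starK mulr1. Qed.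

Lemma selfadjointV x : selfadjoint x -> x \is a GRing.unit -> selfadjoint x^-1.
Proof.
move=> sx ux; rewrite /selfadjoint -[LHS](mulrK ux) -{2}sx -starM divrr //.
by rewrite star1 mul1r.
Qed.

Lemma selfadjointX x n : selfadjoint x -> selfadjoint (x ^+ n).
Proof.
move=> sx; rewrite /selfadjoint; elim: n => [|n IH]; first by rewrite !expr0 star1.
by rewrite exprS starM IH sx -exprSr exprS.
Qed.

Lemma selfadjointM x y : selfadjoint x -> selfadjoint y -> GRing.comm x y ->
  selfadjoint (x * y).
Proof. by move=> sx sy cxy; rewrite /selfadjoint starM sx sy. Qed.

Lemma selfadjointD x y : selfadjoint x -> selfadjoint y -> selfadjoint (x + y).
Proof. by move=> sx sy; rewrite /selfadjoint starD sx sy. Qed.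

Lemma selfadjointZ (t : R) x : selfadjoint x -> selfadjoint (t%:C *: x).
Proof. by move=> sx; rewrite /selfadjoint starZ sx; congr (_ *: _);
  exact: conjc_real. Qed.

Lemma selfadjoint1 : selfadjoint (1 : A). Proof. exact: star1. Qed.

End SelfAdjoint.

Section State.
Variables (R : realType) (A : cStarAlgType R) (phi : {scalar A}).
Hypothesis hphi : is_state phi.
Implicit Types x y : A.

Let phi1 : phi 1 = 1. Proof. by case: hphi. Qed.

Lemma ge0_complexE (z : R[i]) : 0 <= z -> z = (complex.Re z)%:C /\ 0 <= complex.Re z.
Proof. by case: z => u v; rewrite lecE /= => /andP[/eqP -> u0]. Qed.

Lemma state_sqr x : selfadjoint x -> exists2 t : R, phi (x * x) = t%:C & 0 <= t.
Proof.
move=> sx; case: hphi => _ /(_ x); rewrite sx => /ge0_complexE[e t0].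
by exists (complex.Re (phi (x * x))).
Qed.

(** Expand [phi ((1 + x)^2)]: positivity makes this value and [phi (x^2)] real, hence also
    [2 phi(x)]. *)
Lemma state_real x : selfadjoint x -> exists t : R, phi x = t%:C.
Proof.
move=> sx; have [t et _] := state_sqr sx.
have [u eu _] := state_sqr (selfadjointD (selfadjoint1 A) sx).
exists (complex.Re (phi x)).
have : phi ((1 + x) * (1 + x)) = 1 + phi x *+ 2 + t%:C.
  rewrite mulrDl mul1r mulrDr mulr1 !linearD /= phi1 et; ring.
rewrite eu => e; have {}e : phi x *+ 2 = (u - 1 - t)%:C.
  by rewrite !rmorphB /= rmorph1 e; ring.
move: e; case: (phi x) => v w; rewrite mulr2n => -[_ /eqP].
by rewrite -mulr2n mulrn_eq0 /= => /eqP ->.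
Qed.

(* Positivity of [phi] on [(x + t y)^2] for [t = 1 / e] and [t = - 1 / e]. *)
Lemma state_cross_bound x y (p q s e : R) :
  selfadjoint x -> selfadjoint y -> GRing.comm x y ->
  phi (x * x) = p%:C -> phi (x * y) = q%:C -> phi (y * y) = s%:C ->
  0 < e -> s <= e ^+ 2 -> `|q| <= e * ((p + 1) / 2).
Proof.
move=> sx sy cxy ep eq es e0 se.
have H (t : R) : 0 <= p + 2 * t * q + t ^+ 2 * s.
  have [u eu u0] := state_sqr (selfadjointD sx (selfadjointZ t sy)).
  suff <- : u = p + 2 * t * q + t ^+ 2 * s by [].
  apply: (@complexI R); rewrite -eu mulrDl !mulrDr -!scalerAl -!scalerAr.
  rewrite -cxy !linearD !linearZ /= ep eq es scalerA.
  by rewrite !(rmorphD, rmorphM) /= -!mulrA; ring.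
have ts (t : R) : t ^+ 2 = e ^- 2 -> 0 <= p + 1 + 2 * t * q.
  move=> t2; have := H t; rewrite t2.
  have : e ^- 2 * s <= 1 by rewrite mulrC ler_pdivrMr ?exprn_gt0 // mul1r.
  lra.
have h1 := ts e^-1 (exprVn _ _); have := ts (- e^-1).
rewrite sqrrN exprVn => /(_ erefl) h2.
have eV : e * e^-1 = 1 by rewrite divff // gt_eqF.
have e1 : q = e * (e^-1 * q) by rewrite mulrA eV mul1r.
rewrite [in X in X <= _]e1 normrM gtr0_norm // ler_pM2l // ler_norml.
by apply/andP; split; lra.
Qed.

(** * Positive moments from the negative ones *)

Section LaurentMoments.
Variables (x : A) (a rho : R) (W : nat -> int -> R).
Hypotheses (sx : selfadjoint x) (ux : x \is a GRing.unit).
Hypotheses (rho0 : 0 < rho) (rho1 : rho < 1).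
Hypothesis WS : forall K k, W K.+1 k = W K k - a * W K (k - 1).
Hypothesis W_bound : forall K k, 0 <= W K k <= rho ^+ K * W 0 k.
Hypothesis W00 : W 0 0 = 1.
Hypothesis W_neg : forall n : nat, phi (x ^ (- n%:Z)) = (W 0 (- n%:Z))%:C.

Let u : A := 1 + (- a)%:C *: x^-1.

(** [W K k] stands for the integral of [x^k (1 - a / x)^K] against the expected law of [x]. *)
Let defect (K : nat) (k : int) : R[i] := phi (x ^ k * u ^+ K) - (W K k)%:C.

Let defectS K k : defect K.+1 k = defect K k - a%:C * defect K (k - 1).
Proof.
rewrite /defect WS exprS mulrA mulrDr mulr1 -scalerAr mulrDl linearD /=
  -scalerAl linearZ /=.
have -> : x ^ k / x = x ^ (k - 1) by rewrite exprzDr // exprN1.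
by rewrite !(rmorphB, rmorphN, rmorphM) /=; ring.
Qed.

Let su : selfadjoint u.
Proof. exact/(selfadjointD (selfadjoint1 A))/selfadjointZ/selfadjointV. Qed.

(* If the moments agree up to order [n - 1], the defect of [x^n u^K] does not
   depend on [K], but it tends to [0] as [K] grows. *)
Let defect0 (n : nat) : forall j : int, j <= n%:Z -> defect 0 j = 0.
Proof.
elim: n => [|n IH] j jn.
  have -> : j = - (`|j|%N)%:Z by lia.
  by rewrite /defect expr0 mulr1 W_neg subrr.
have [jn'|nj] := leP j n%:Z; first exact: IH.
have {j jn nj} -> : j = n.+1%:Z by lia.
have Dn K : forall j : int, j <= n%:Z -> defect K j = 0.
  elim: K => [|K IHK] j jn; first exact: IH.
  by rewrite defectS !IHK ?mulr0 ?subrr //; lia.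
have DK K : defect K n.+1%:Z = defect 0 n.+1%:Z.
  by elim: K => // K IHK;
    rewrite defectS (Dn K (n.+1%:Z - 1)) ?mulr0 ?subr0 ?IHK //; lia.
have cxu K : GRing.comm (x ^+ n.+1) (u ^+ K).
  apply/commrX/commr_sym/commrX/commr_sym.
  apply: commrD; first exact: commr1.
  by rewrite /GRing.comm -scalerAr -scalerAl divrr // mulVr.
have sP K := selfadjointM (selfadjointX n.+1 sx) (selfadjointX K su) (cxu K).
have qP K := cid (state_real (sP K)).
pose q K := projT1 (qP K);
  have eq K : phi (x ^+ n.+1 * u ^+ K) = (q K)%:C := projT2 (qP K).
have [p ep _] := state_sqr (selfadjointX n.+1 sx).
have dE K : defect K n.+1%:Z = (q K - W K n.+1%:Z)%:C by rewrite /defect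
  -exprnP eq rmorphB.
have dC K : q 0%N - W 0 n.+1%:Z = q K - W K n.+1%:Z.
  by apply: (@complexI R); rewrite -!dE DK.
rewrite dE (_ : q 0%N - _ = 0) //.
(* In the constant, [(p + 1) / 2] controls the value of the state and [W 0 n.+1] the integral. *)
apply: (@geometric_squeeze0 _ _ rho ((p + 1) / 2 + W 0 n.+1%:Z)).
  by rewrite rho1 ltW.
move=> K; rewrite (dC K) mulrDr (le_trans (ler_normB _ _)) // lerD //.
  (* Expanding [u^(2K)] involves only moments of order at most 0, which are known. The bound on
     [W (K + K) 0] then allows [e = rho^K] in [state_cross_bound]. *)
  have es : phi (u ^+ K * u ^+ K) = (W (K + K) 0)%:C.
    have /eqP := Dn (K + K)%N 0 isT; rewrite /defect expr0z mul1r exprD subr_eq0.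
    by move/eqP.
  apply: (state_cross_bound (selfadjointX n.+1 sx) (selfadjointX K su) (cxu K)
    ep (eq K) es).
    by rewrite exprn_gt0.
  have /andP[_] := W_bound (K + K) 0.
  by rewrite W00 mulr1 -exprM mulnC mul2n addnn.
by have /andP[w0 wb] := W_bound K n.+1%:Z; rewrite ger0_norm.
Qed.

Lemma state_laurent_moment (k : int) : phi (x ^ k) = (W 0 k)%:C.
Proof.
have := @defect0 `|k|%N k; rewrite /defect expr0 mulr1 => /(_ _)/eqP.
by rewrite subr_eq0 => /(_ ltac:(lia)) /eqP.
Qed.

End LaurentMoments.

End State.

(** * The two laws as probability measures *)

Section Laws.
Variables (R : realType) (c : R).
Hypothesis c0 : 0 < c.
Let r := c + 1.
Let a := (Num.sqrt r - 1) ^+ 2.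
Let b := (Num.sqrt r + 1) ^+ 2.

Let a0 : 0 < a. Proof. exact: mp_left_gt0. Qed.
Let ab : a < b. Proof. exact: mp_left_lt_right. Qed.
Let b0 : 0 < b. Proof. exact: lt_trans ab. Qed.
Let b'0 : 0 < b^-1. Proof. by rewrite invr_gt0. Qed.
Let b'a' : b^-1 < a^-1. Proof. by rewrite ltf_pV2 ?posrE. Qed.

Lemma free_poisson_densityE x : x != 0 ->
  free_poisson_density r 1 x = (2 * pi)^-1 * (x ^ (-1) * semicircle a b x).
Proof.
move=> x0; rewrite /free_poisson_density /semicircle exprN1 mulr1.
have -> : 4 * r * 1 ^+ 2 - (x - 1 * (1 + r)) ^+ 2 = (x - a) * (b - x).
  have -> : (x - a) * (b - x) = (a + b) * x - a * b - x ^+ 2 by ring.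
  by rewrite mp_endsM // mp_endsD // /r; ring.
by rewrite div1r invfM mulrA.
Qed.

Lemma free_gamma_densityE x : x != 0 ->
  free_gamma_density r 1 x =
  c / (2 * pi) * (x ^ (- 2%:Z) * semicircle b^-1 a^-1 x).
Proof.
move=> x0; rewrite /free_gamma_density /semicircle.
have c0' : c != 0 by rewrite gt_eqF.
have -> : 4 * r / (1 ^+ 2 * (r - 1) ^+ 4) - (x - (r + 1) / (1 * (r - 1) ^+ 2)) ^+ 2
    = (x - b^-1) * (a^-1 - x).
  have -> : (x - b^-1) * (a^-1 - x) = ((a + b) * x - 1) / (a * b) - x ^+ 2.
    by field; rewrite !gt_eqF.
  by rewrite mp_endsM // mp_endsD // /r; field; rewrite c0'.
rewrite -exprnN /r addrK; move: (Num.sqrt _) (pi : R) (gt_eqF (pi_gt0 R)) => S p p0.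
by field; rewrite x0 p0.
Qed.

Lemma free_poisson_law : exists nu : probability (measurableTypeR R) R,
  (forall B, measurable B -> nu B = free_poisson r 1 B) /\
  (forall n : nat,
     nu.-integrable [set: measurableTypeR R] (fun t => (t ^+ n)%:E) /\
     (\int[nu]_t (t ^+ n))%R = mp_moment c n%:Z).
Proof.
have pos x : a <= x <= b -> 0 < x by move=> /andP[+ _]; exact: lt_le_trans.
pose f (x : R) := (2 * pi)^-1 * (x ^ (-1) * semicircle a b x).
have cf x : a <= x <= b -> {for x, continuous f}.
  by move=> xab; apply: cvgM; [exact: cvg_cst|exact: continuous_exprz_semicircle].
have f0 x : a <= x <= b -> 0 <= f x.
  move=> xab; rewrite mulr_ge0 ?invr_ge0 ?mulr_ge0 ?pi_ge0 ?sqrtr_ge0 //.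
  by rewrite exprz_ge0 // ltW // pos.
have fint (n : nat) : \int[lebesgue_measure]_(x in `[a, b]%classic) (x ^+ n * f x) =
    mp_moment c n%:Z.
  rewrite /mp_moment -RintegralZl //; last exact: integrable_exprz_semicircle.
  apply: eq_Rintegral => x; rewrite inE /= in_itv /= => /pos x0.
  by rewrite /f [x ^ (n%:Z - 1)]exprzDr ?unitfE ?gt_eqF // mulrCA;
    congr (_ * _); exact: mulrA.
have [|nu [nuB nuI]] := exists_density_law cf f0.
  by rewrite -(mp_moment0 c0) -(fint 0%N); apply: eq_Rintegral => x _; rewrite mul1r.
exists nu; split=> [B mB|n].
  (* Since [lambda = r > 1], the atom at 0 has mass zero. *)
  rewrite nuB // /free_poisson (max_idPl _) ?subr_le0 ?lerDr ?ltW //.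
  rewrite mul0e add0e /free_poisson_support !mul1r.
  rewrite (_ : (1 - Num.sqrt r) ^+ 2 = a); last by rewrite /a; ring.
  rewrite (_ : (1 + Num.sqrt r) ^+ 2 = b); last by rewrite /b; ring.
  apply: eq_integral => x; rewrite inE => -[_ /=]; rewrite in_itv /= => /andP[ax _].
  by rewrite free_poisson_densityE // gt_eqF // (lt_trans a0).
have [i e] := nuI _ (@exprn_continuous _ n); split=> //.
by rewrite e fint.
Qed.

Lemma free_gamma_law : exists nu : probability (measurableTypeR R) R,
  (forall B, measurable B -> nu B = free_gamma r 1 B) /\
  (forall n : nat,
     nu.-integrable [set: measurableTypeR R] (fun t => (t ^+ n)%:E) /\
     (\int[nu]_t (t ^+ n))%R = fg_moment c n).
Proof.
have pos x : b^-1 <= x <= a^-1 -> 0 < x by move=> /andP[+ _]; exact: lt_le_trans.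
pose f (x : R) := c / (2 * pi) * (x ^ (- 2%:Z) * semicircle b^-1 a^-1 x).
have cf x : b^-1 <= x <= a^-1 -> {for x, continuous f}.
  by move=> xab; apply: cvgM; [exact: cvg_cst|exact: continuous_exprz_semicircle].
have f0 x : b^-1 <= x <= a^-1 -> 0 <= f x.
  move=> xab; rewrite mulr_ge0 ?divr_ge0 ?mulr_ge0 ?pi_ge0 ?sqrtr_ge0 ?(ltW c0) //.
  by rewrite exprz_ge0 // ltW // pos.
have fint (n : nat) : \int[lebesgue_measure]_(x in `[b^-1, a^-1]%classic) (x ^+
  n * f x) =
    fg_moment c n.
  rewrite /fg_moment -RintegralZl //; last exact: integrable_exprz_semicircle.
  apply: eq_Rintegral => x; rewrite inE /= in_itv /= => /pos x0.
  by rewrite /f [x ^ (n%:Z - 2)]exprzDr ?unitfE ?gt_eqF // mulrCA;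
    congr (_ * _); exact: mulrA.
have [|nu [nuB nuI]] := exists_density_law cf f0.
  by rewrite -(fg_moment0 c0) -(fint 0%N); apply: eq_Rintegral => x _; rewrite mul1r.
exists nu; split=> [B mB|n].
  rewrite nuB // /free_gamma /free_gamma_support !mul1r.
  rewrite (_ : (1 - Num.sqrt r) ^+ 2 = a); last by rewrite /a; ring.
  rewrite (_ : (1 + Num.sqrt r) ^+ 2 = b); last by rewrite /b; ring.
  apply: eq_integral => x; rewrite inE => -[_ /=]; rewrite in_itv /= => /andP[ax _].
  by rewrite free_gamma_densityE // gt_eqF // (lt_trans b'0).
have [i e] := nuI _ (@exprn_continuous _ n); split=> //.
by rewrite e fint.
Qed.

End Laws.

(** The equation for [m2] is the moment recursion at [n = 1]. In terms of the variance [v] of [X^-1]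
    it reads [c^-1 = c^2 v], and [v] is nonnegative. *)
Lemma state_mean_gt1 (R : realType) (A : cStarAlgType R) (phi : {scalar A})
    (X : A) (c : R) (m2 : R[i]) : is_state phi -> selfadjoint X ->
  X \is a GRing.unit -> c != 0 -> phi X^-1 = (c^-1)%:C ->
  phi (X^-1 ^+ 2) = m2 -> 2 * (c ^+ 2)%:C * m2 = (c + 2)%:C * (c^-1)%:C + 1 ->
  0 < c.
Proof.
move=> hphi sX uX c0 e1 e2 em2.
have sY := selfadjointV sX uX.
have sZ := selfadjointD sY (selfadjointZ (- c^-1) (selfadjoint1 A)).
have [v ev v0] := state_sqr hphi sZ.
have {}ev : m2 = (v + c^-1 ^+ 2)%:C.
  move: ev; rewrite -e2 mulrDl !mulrDr -!scalerAl -!scalerAr !mulr1 !mul1r.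
  rewrite !linearD !linearZ /= e1 (proj1 hphi) -expr2 => ev.
  rewrite -[LHS](addrK (- (c^-1 ^+ 2)%:C)) opprK rmorphD /= -ev; congr (_ + _).
  by rewrite !(rmorphXn, rmorphN) /=; ring.
have {em2 ev} : 2 * c ^+ 2 * (v + c^-1 ^+ 2) = (c + 2) * c^-1 + 1.
  apply: (@complexI R); rewrite !(rmorphM, rmorphD) /= -!rmorphD /= in em2 *.
  by rewrite -em2 ev !(rmorphM, rmorphD, rmorphXn, rmorph_nat) /=.
have -> : 2 * c ^+ 2 * (v + c^-1 ^+ 2) = 2 * c ^+ 2 * v + 2 by field.
have -> : (c + 2) * c^-1 + 1 = 2 / c + 2 by field.
move=> /addIr e; rewrite lt0r c0 /= -invr_ge0.
have -> : c^-1 = c ^+ 2 * v by lra.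
by rewrite mulr_ge0 // exprn_even_ge0.
Qed.

(** * Cumulants and laws of [X^-1] and [X] *)

Theorem mainTheorem3 (R : realType) (A : cStarAlgType R) (phi : {scalar A})
    (hphi : is_state phi) (X : A) (hXsa : selfadjoint X)
    (hXinv : X \is a GRing.unit)
    (hcum : forall n : nat, (1 <= n)%N ->
      free_cumulant phi (X :: nseq n X^-1)
      = - free_cumulant phi (nseq n X^-1)) :
  [/\ free_cumulant phi [:: X] - 1 != 0,
      forall n : nat, (1 <= n)%N ->
        free_cumulant phi (nseq n X^-1)
        = 1 / (free_cumulant phi [:: X] - 1) ^+ (2 * n - 1)
          * catalan R[i] (n - 1),
      has_free_gamma_distribution phi X^-1
    & has_free_poisson_distribution phi X].
Proof.
have phi1 : phi 1 = 1 by case: hphi.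
pose m n := phi (X^-1 ^+ n).
pose r := free_cumulant phi [:: X].
pose Rc n := free_cumulant phi (nseq n X^-1).
have m0 : m 0%N = 1 by rewrite /m expr0.
have mS (n : nat) (M : {poly R[i]}) : (forall i, (i <= n)%N -> M`_i = m i) ->
    m n.+1 = \sum_(k < n.+1) Rc k.+1 * (M ^+ k.+1)`_(n - k).
  move=> HM; rewrite /m exprS (moment_first_coef _ phi1 (leqnn n) HM).
  by apply: eq_bigr.
(* As [X] cancels one factor [X^-1], the mixed moments are moments of [X^-1] of order one less. The
   one-element block of [X] gives the term in [r], and [hcum] rewrites all the others. *)
have mX (n : nat) (M : {poly R[i]}) : (forall i, (i <= n)%N -> M`_i = m i) ->
    (if n is n'.+1 then m n' else r) =
    r * M`_n - \sum_(k < n) Rc k.+1 * (M ^+ k.+2)`_(n - k.+1).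
  move=> HM; have := moment_first_coef X phi1 (leqnn n) HM.
  rewrite big_ord_recl subn0 expr1 -sumrN => e.
  transitivity (phi (X * X^-1 ^+ n)).
    case: n M HM e => [|n] M HM e; last by rewrite exprS mulrA divrr // mul1r.
    by rewrite e big_ord0 addr0 HM // m0 mulr1.
  rewrite e; congr (_ + _); apply: eq_bigr => k _.
  by rewrite (_ : lift ord0 k = k.+1 :> nat) // hcum // mulNr.
have cR1 := cumulant1 m0 mS mX.
(* From [c R_1 = 1]; hence the cumulant formula never divides by zero. *)
have c0 : r - 1 != 0.
  by apply/eqP => c0; move/eqP: cR1; rewrite c0 mul0r eq_sym oner_eq0.
have R1 : Rc 1%N = (r - 1)^-1 by apply: (mulfI c0); rewrite cR1 divff.
have m1 : m 1%N = (r - 1)^-1.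
  (* The constant polynomial 1 is the moment series truncated at order 0. *)
  rewrite (mS 0%N 1) ?big_ord_recl ?big_ord0 ?R1 ?expr1 ?coef1 ?mulr1 ?addr0 //.
  by move=> i; rewrite leqn0 => /eqP ->; rewrite coef1.
have mrec := moment_rec m0 mS mX.
have rE : phi X = r.
  have := moment_first_coef X phi1 (leqnn 0) (M := 1) (y := X^-1).
  rewrite expr0 mulr1 big_ord1 expr1 coef1 mulr1; apply=> i.
  by rewrite leqn0 => /eqP ->; rewrite coef1 expr0 phi1.
(* Self-adjointness of [X] makes [r] real, so the moments can be compared with real integrals. *)
have [t et] := state_real hphi hXsa.
pose c := t - 1; have tc : t = c + 1 by rewrite subrK.
have rc : r = (c + 1)%:C by rewrite -rE et tc.
have r1 : r - 1 = c%:C by rewrite rc rmorphD /= rmorph1 addrK.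
rewrite r1 in c0 m1 mrec.
have cn0 : c != 0 by apply: contraNneq c0 => ->.
have cV : (c%:C)^-1 = (c^-1)%:C by rewrite -fmorphV.
have cgt0 : 0 < c.
  apply: (state_mean_gt1 hphi hXsa hXinv cn0 _ erefl); first by rewrite -cV -m1.
  have := mrec 1%N isT; rewrite -/(m 2) m0 /= m1 cV => e.
  rewrite rmorphXn /= e rc !rmorphD /= !rmorph1; ring.
have m_mp : m =1 (fun n => (mp_moment c (- n%:Z))%:C).
  apply: (three_term_rec_unique c0 _ _ mrec).
  - by rewrite m0 mp_moment0.
  - by rewrite m1 mp_momentN1.
  - move=> k k0; have := congr1 (fun x => x%:C) (mp_moment_rec cgt0 k0).
    rewrite !(rmorphB, rmorphM, rmorphXn, rmorph_nat) /= rc => ->.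
    by rewrite !(rmorphD, rmorphB, rmorphM, rmorph_nat, rmorph1).
have m_fg : m =1 (fun n => (fg_moment c n)%:C).
  apply: (three_term_rec_unique c0 _ _ mrec).
  - by rewrite m0 fg_moment0.
  - by rewrite m1 fg_moment1.
  - move=> k k0; have := congr1 (fun x => x%:C) (fg_moment_rec cgt0 k0).
    rewrite !(rmorphB, rmorphM, rmorphXn, rmorph_nat) /= rc => ->.
    by rewrite !(rmorphD, rmorphB, rmorphM, rmorph_nat, rmorph1).
have c1 : 1 < c + 1 by rewrite ltrDr.
pose a := (Num.sqrt (c + 1) - 1) ^+ 2; pose b := (Num.sqrt (c + 1) + 1) ^+ 2.
have a0 : 0 < a := mp_left_gt0 cgt0.
have ab : a < b := mp_left_lt_right cgt0.
(* The shift to [k - 1] comes from the factor [1 / x] of the free Poisson density; the ratio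
   [1 - a / b] below is the maximum of [1 - a / x] on [[a, b]]. *)
pose W K k := (2 * pi)^-1 * weighted_moment a b K (k - 1).
have W0 k : W 0%N k = mp_moment c k by rewrite /W weighted_moment0.
have X_mp k : phi (X ^ k) = (mp_moment c k)%:C.
  rewrite -W0; apply: (@state_laurent_moment _ _ _ hphi X a (1 - a / b) W) => //.
  - by rewrite subr_gt0 ltr_pdivrMr ?mul1r // (lt_trans a0).
  - by rewrite gtrBl divr_gt0 // (lt_trans a0).
  - by move=> K j; rewrite /W weighted_momentS // mulrBr mulrCA.
  - move=> K j; have pi2 : 0 <= (2 * pi)^-1 :> R by rewrite invr_ge0 mulr_ge0 ?pi_ge0.
    have /andP[w0 wb] := weighted_moment_bound a0 ab K (j - 1).
    rewrite mulr_ge0 //= /W weighted_moment0 mulrCA.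
    exact: ler_wpM2l wb.
  - by rewrite W0 mp_moment0.
  - by move=> n; rewrite W0 -m_mp -exprnN -exprVn.
split=> //.
- by rewrite -/r r1.
- by apply: cumulant_catalan; [rewrite -/r r1|exact: R1|exact: cumulant_rec m0 mS mX].
- exists (c + 1), 1; split=> //.
  have [nu [nuB nuI]] := free_gamma_law cgt0; exists nu; split=> // n _.
  by have [i e] := nuI n; split=> //; rewrite e -m_fg.
- exists (c + 1), 1; split=> //; first by rewrite ltW // (lt_trans _ c1).
  have [nu [nuB nuI]] := free_poisson_law cgt0; exists nu; split=> // n _.
  by have [i e] := nuI n; split=> //; rewrite e -X_mp.
Qed.
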